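(* For well-formed networks of the calculus CaIT the following hold. (1) $n[\mathcal I\bowtie a!v.P\parallel R]^\mu_h\gtrsim n[\mathcal I\bowtie P\parallel R]^\mu_h$ if $\mathcal I(a)=v$ and $a$ does not occur in $R$. (2) $n[\mathcal I\bowtie @(x).P\parallel R]^\mu_h\gtrsim n[\mathcal I\bowtie P\{h/x\}\parallel R]^\mu_h$. (3) $n[\mathcal I\bowtie \lfloor\overline c\langle v\rangle.P\rfloor S\parallel\lfloor c(x).Q\rfloor T\parallel R]^\mu_h\gtrsim n[\mathcal I\bowtie P\parallel Q\{v/x\}\parallel R]^\mu_h$ if $c$ does not occur in $R$ and $\mathrm{rng}(c)=-1$. (4) $(\nu c)\big(n[\mathcal I\bowtie\lfloor\overline c\langle v\rangle.P\rfloor S\parallel R]^\mu_h\mid m[\mathcal J\bowtie\lfloor c(x).Q\rfloor T\parallel U]^{\mu'}_k\big)\gtrsim(\nu c)\big(n[\mathcal I\bowtie P\parallel R]^\mu_h\mid m[\mathcal J\bowtie Q\{v/x\}\parallel U]^{\mu'}_k\big)$ if $\mathrm{rng}(c)=\infty$ and $c$ occurs neither in $R$ nor in $U$. (5) $n[\mathcal I\bowtie P]^\mu_h\approx n[\mathcal I\bowtie\mathsf{nil}]^\mu_h$ if no subterm of the form $\lfloor\pi.P_1\rfloor P_2$ or $a!v.P_1$ occurs in $P$. (6) $n[\mathcal I\bowtie\mathsf{nil}]^\mu_h\approx\mathbf 0$ if $\mathcal I(a)$ is undefined for every actuator $a$. (7) $n[\emptyset\bowtie P]^{\mathsf m}_h\approx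 m[\emptyset\bowtie P]^{\mathsf s}_k$ if $P$ contains no subterm of the form $@(x).Q$ and every channel $c$ occurring in $P$ has $\mathrm{rng}(c)=\infty$ or $\mathrm{rng}(c)=-1$.
   Context: The calculus CaIT. Fix a set of locations with a distance $d(h,k)\in\mathbb N$ between locations, a constant $\delta\in\mathbb N$, and a function $\mathrm{rng}$ giving each channel $c$ a range $\mathrm{rng}(c)\in\mathbb N\cup\{-1,\infty\}$. Values $v,w$ include basic values, sensor/actuator values and locations; boolean guards $b$ are decidable. Processes: $P,Q::=\mathsf{nil}\mid \rho.P\mid P\parallel Q\mid \lfloor\pi.P\rfloor Q\mid [b]P;Q\mid X\mid \mathsf{fix}\,X.P$ with $\rho\in\{\sigma,\ @(x),\ s?(x),\ a!v\}$ ($s$ a sensor, $a$ an actuator) and $\pi\in\{\overline{c}\langle v\rangle,\ c(x)\}$. The variable $x$ is bound in $c(x).P$, $s?(x).P$, $@(x).P$ and $X$ in $\mathsf{fix}X.P$; in $\sigma.Q$ and $\lfloor\pi.P\rfloor Q$ the occurrence of $Q$ is time-guarded, and in $\mathsf{fix}X.P$ all occurrences of $X$ must be time-guarded. Networks: $M,N::=\mathbf 0\mid n[\mathcal I\bowtie P]^{\mu}_{h}\mid M\mid N\mid (\nu c)M$, where $n$ is a node name, $\mathcal I$ a partial map from sensor and actuator names to values (physical interface), $\mu\in\{\mathsf s,\mathsf m\}$ (stationary/mobile) and $h$ a location. Sensors are node-dependent or location-dependent. Networks are closed and well-formed: node names are distinct; distinct nodes have distinct actuators and distinct node-dependent sensors;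 if $P$ in $n[\mathcal I\bowtie P]^\mu_h$ contains $s?(x)$ (resp. $a!v$) then $\mathcal I(s)$ (resp. $\mathcal I(a)$) is defined; a node whose interface defines a location-dependent sensor is stationary. $T\{v/x\}$ is substitution. Structural congruence $\equiv$ is the least congruence with: $\parallel$ commutative, associative, unit $\mathsf{nil}$; $[b]P;Q\equiv P$ if $b$ true, $\equiv Q$ if $b$ false; $\mathsf{fix}X.P\equiv P\{\mathsf{fix}X.P/X\}$; $P\equiv Q$ implies $n[\mathcal I\bowtie P]^\mu_h\equiv n[\mathcal I\bowtie Q]^\mu_h$; network $\mid$ commutative, associative, unit $\mathbf 0$; $(\nu c)\mathbf 0\equiv\mathbf 0$; $(\nu c)(\nu d)M\equiv(\nu d)(\nu c)M$; $(\nu c)(M\mid N)\equiv M\mid(\nu c)N$ if $c$ not in $M$. Labelled (intensional) semantics. Process transitions $P\xrightarrow{\lambda}P'$, $\lambda\in\{\sigma,\tau,\overline cv,cv,@h,s?v,a!v\}$, with $[b]P;Q$ identified with $P$ if $b$ is true and with $Q$ otherwise, are the least relation closed under: $\lfloor\overline c\langle v\rangle.P\rfloor Q\xrightarrow{\overline cv}P$; $\lfloor c(x).P\rfloor Q\xrightarrow{cv}P\{v/x\}$ (any $v$); $s?(x).P\xrightarrow{s?v}P\{v/x\}$ (any $v$); $a!v.P\xrightarrow{a!v}P$; $@(x).P\xrightarrow{@h}P\{h/x\}$ (any $h$); if $P\xrightarrow{\overline cv}P'$, $Q\xrightarrow{cv}Q'$ and $\mathrm{rng}(c)=-1$ then $P\parallel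 Q\xrightarrow{\tau}P'\parallel Q'$ and $Q\parallel P\xrightarrow{\tau}Q'\parallel P'$; if $P\xrightarrow{\lambda}P'$ with $\lambda\ne\sigma$ then $P\parallel Q\xrightarrow{\lambda}P'\parallel Q$ and $Q\parallel P\xrightarrow{\lambda}Q\parallel P'$; if $P\{\mathsf{fix}X.P/X\}\xrightarrow{\lambda}Q$ then $\mathsf{fix}X.P\xrightarrow{\lambda}Q$; $\mathsf{nil}\xrightarrow{\sigma}\mathsf{nil}$; $\sigma.P\xrightarrow{\sigma}P$; $\lfloor\pi.P\rfloor Q\xrightarrow{\sigma}Q$; if $P\xrightarrow{\sigma}P'$, $Q\xrightarrow{\sigma}Q'$ and $P\parallel Q$ has no $\tau$-transition then $P\parallel Q\xrightarrow{\sigma}P'\parallel Q'$. Network transitions $M\xrightarrow{\nu}M'$, $\nu\in\{\sigma,\tau,a,\overline cv@h,cv@h\}$, are the least relation closed under (for a node $n[\mathcal I\bowtie P]^\mu_h$): if $P\xrightarrow{@h}P'$ then node $\xrightarrow{\tau}n[\mathcal I\bowtie P']^\mu_h$; if $\mathcal I(s)=v$ and $P\xrightarrow{s?v}P'$ then node $\xrightarrow{\tau}n[\mathcal I\bowtie P']^\mu_h$; if $\mathcal I(a)=v$ and $P\xrightarrow{a!v}P'$ then node $\xrightarrow{\tau}n[\mathcal I\bowtie P']^\mu_h$; if $\mathcal I(a)\ne v$ and $P\xrightarrow{a!v}P'$ then node $\xrightarrow{a}n[\mathcal I[a\mapsto v]\bowtie P']^\mu_h$; if $P\xrightarrow{\tau}P'$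 then node $\xrightarrow{\tau}n[\mathcal I\bowtie P']^\mu_h$; if $P\xrightarrow{\sigma}P'$ and the node has no $\tau$-transition then $n[\mathcal I\bowtie P]^{\mathsf s}_h\xrightarrow{\sigma}n[\mathcal I\bowtie P']^{\mathsf s}_h$ and $n[\mathcal I\bowtie P]^{\mathsf m}_h\xrightarrow{\sigma}n[\mathcal I\bowtie P']^{\mathsf m}_k$ for every $k$ with $d(h,k)\le\delta$; if $P\xrightarrow{\overline cv}P'$ (resp. $\xrightarrow{cv}$) and $\mathrm{rng}(c)\ge0$ then node $\xrightarrow{\overline cv@h}$ (resp. $\xrightarrow{cv@h}$) $n[\mathcal I\bowtie P']^\mu_h$; if $M\xrightarrow{\overline cv@k}M'$, $N\xrightarrow{cv@h}N'$ and $d(h,k)\le\mathrm{rng}(c)$ then $M\mid N\xrightarrow{\tau}M'\mid N'$ and $N\mid M\xrightarrow{\tau}N'\mid M'$; if $M\xrightarrow{\nu}M'$, $\nu\ne\sigma$, then $M\mid N\xrightarrow{\nu}M'\mid N$ and $N\mid M\xrightarrow{\nu}N\mid M'$; if $M\xrightarrow{\sigma}M'$, $N\xrightarrow{\sigma}N'$ and $M\mid N$ has no $\tau$-transition then $M\mid N\xrightarrow{\sigma}M'\mid N'$; $\mathbf 0\xrightarrow{\sigma}\mathbf 0$; if $M\xrightarrow{\nu}N$ and $\nu$ is not of the form $\overline cv@h$ or $cv@h$ then $(\nu c)M\xrightarrow{\nu}(\nu c)N$. Barb: $M\downarrow_{a!v@h}$ iff $M\equiv(\nu\tilde g)(n[\mathcal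 I\bowtie P]^\mu_h\mid M')$ with $\mathcal I(a)=v$. Sensor update: $n[\mathcal I\bowtie P]^\mu_h[s@h\mapsto v]=n[\mathcal I[s\mapsto v]\bowtie P]^\mu_h$ if $\mathcal I(s)$ is defined; a node is unchanged if $\mathcal I(s)$ is undefined or it is located at $k\ne h$; the update distributes over $\mid$ and $(\nu c)$, and $\mathbf 0[s@h\mapsto v]=\mathbf 0$. Extensional semantics: the transitions labelled $\tau,\sigma,a$ are those above; in addition (i) if $M\xrightarrow{\overline cv@h}M'$ and $d(h,k)\le\mathrm{rng}(c)$ then $M\xrightarrow{\overline cv\triangleright k}M'$; (ii) if $M\xrightarrow{cv@h}M'$ and $d(k,h)\le\mathrm{rng}(c)$ then $M\xrightarrow{cv\triangleleft k}M'$; (iii) for every sensor $s$, location $h$ and $v$ in the domain of $s$, $M\xrightarrow{s?v@h}M[s@h\mapsto v]$; (iv) if $M\downarrow_{a!v@h}$ then $M\xrightarrow{a!v@h}M$. Let $\alpha$ range over extensional labels. $\Rightarrow$ is $(\xrightarrow{\tau})^*$, $\xRightarrow{\alpha}$ is $\Rightarrow\xrightarrow{\alpha}\Rightarrow$, and $\xRightarrow{\hat\alpha}$ is $\Rightarrow$ if $\alpha=\tau$ and $\xRightarrow{\alpha}$ otherwise. A symmetric relation $\mathcal R$ is a bisimulation if $M\,\mathcal R\,N$ and $M\xrightarrow{\alpha}M'$ imply $N\xRightarrow{\hat\alpha}N'$ with $M'\,\mathcal R\,N'$; $\approx$ is the union of all bisimulations. Expansion: a relation $\mathcal R$ is an expansion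 if $M\,\mathcal R\,N$ implies (a) $M\xrightarrow{\alpha}M'$ gives $N'$ with $M'\,\mathcal R\,N'$ and either $N\xrightarrow{\alpha}N'$, or $\alpha=\tau$ and $N'=N$; (b) $N\xrightarrow{\alpha}N'$ gives $M\xRightarrow{\alpha}M'$ (for $\alpha=\tau$, at least one $\tau$-step) with $M'\,\mathcal R\,N'$; $M\gtrsim N$ iff $M\,\mathcal R\,N$ for some expansion $\mathcal R$ (in particular $M\gtrsim N$ implies $M\approx N$). *)

(* Defs.v *)
From mathcomp Require Import all_boot.
From Stdlib Require Import Relations.

Set Implicit Arguments.
Unset Strict Implicit.
Unset Printing Implicit Defensive.

(* Ranges in N + {-1, oo}: RInt is -1 (intra-node channels), RInf is oo. *)
Inductive range := RInt | RFin of nat | RInf.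

Definition within (d : nat) (r : range) : bool :=
  match r with RInt => false | RFin k => d <= k | RInf => true end.

(* [data] gathers the basic values and the values of sensors and actuators. *)
Inductive value (data loc : Type) := VData of data | VLoc of loc.
Arguments VData {data loc} _.
Arguments VLoc {data loc} _.

Record cait := Cait {
  loc : eqType;
  chan : eqType;
  sensor : eqType;
  actuator : eqType;
  nodename : eqType;
  data : Type;
  dist : loc -> loc -> nat;
  dist_self : forall h, dist h h = 0;
  delta : nat;
  rng : chan -> range;
  (* true: location-dependent; false: node-dependent *)
  locdep : sensor -> bool;
  sdom : sensor -> value data loc -> Prop
}.
Arguments dist {c} _ _.
Arguments delta : clear implicits.
Arguments rng {c} _.
Arguments locdep {c} _.
Arguments sdom {c} _ _.

Inductive mobility := Stat | Mob.

Section CaIT.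
Variable C : cait.

Notation val := (value (data C) (loc C)).

(* Variables are de Bruijn indices, so that processes are identified up to
   alpha-conversion; value variables and process variables are indexed
   separately.  Index 0 refers to the innermost binder of its kind. *)
Inductive vterm := Val of val | Var of nat.

(* A guard b is a decidable predicate [f] applied to values or variables. *)
Inductive proc :=
| PNil
| PDelay of proc                               (* sigma.P *)
| PLoc of proc                                 (* @(x).P, binds x *)
| PSense of sensor C & proc                    (* s?(x).P, binds x *)
| PAct of actuator C & vterm & proc            (* a!u.P *)
| PPar of proc & proc
| PSend of chan C & vterm & proc & proc        (* timed output, else Q *)
| PRecv of chan C & proc & proc                (* timed c(x).P, else Q;
                                                  binds x in P only *)
| PIf (f : seq val -> bool) (us : seq vterm) (P Q : proc)
| PVar of nat
| PFix of proc.                                (* binds X *)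

Definition iface := (sensor C + actuator C)%type -> option val.

Definition iface0 : iface := fun _ => None.

Definition iupd (I : iface) (x : (sensor C + actuator C)%type) (v : val) :
  iface := fun y => if y == x then Some v else I y.

(* Channel names are kept as names: they are not values, hence are never
   substituted by the reduction rules.  Alpha-conversion of restricted
   channels is the rule [ncong_alpha] below. *)
Inductive net :=
| NNil
| NNode (n : nodename C) (I : iface) (P : proc) (mu : mobility) (h : loc C)
| NPar of net & net
| NRes of chan C & net.

(** Substitution *)

Definition usubst (k : nat) (v : val) (u : vterm) : vterm :=
  match u with
  | Val w => Val w
  | Var j => if j == k then Val v else Var (if k < j then j.-1 else j)
  end.

(* P{v/x}, for x the value variable of index k *)
Fixpoint psubst (k : nat) (v : val) (P : proc) : proc :=
  match P with
  | PNil => PNil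
  | PDelay P => PDelay (psubst k v P)
  | PLoc P => PLoc (psubst k.+1 v P)
  | PSense s P => PSense s (psubst k.+1 v P)
  | PAct a u P => PAct a (usubst k v u) (psubst k v P)
  | PPar P Q => PPar (psubst k v P) (psubst k v Q)
  | PSend c u P Q => PSend c (usubst k v u) (psubst k v P) (psubst k v Q)
  | PRecv c P Q => PRecv c (psubst k.+1 v P) (psubst k v Q)
  | PIf f us P Q => PIf f (map (usubst k v) us) (psubst k v P) (psubst k v Q)
  | PVar X => PVar X
  | PFix P => PFix (psubst k v P)
  end.

Definition uliftv (k : nat) (u : vterm) : vterm :=
  match u with
  | Val w => Val w
  | Var j => Var (if k <= j then j.+1 else j)
  end.

(* shifts the free value variables of index at least k *)
Fixpoint pliftv (k : nat) (P : proc) : proc :=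
  match P with
  | PNil => PNil
  | PDelay P => PDelay (pliftv k P)
  | PLoc P => PLoc (pliftv k.+1 P)
  | PSense s P => PSense s (pliftv k.+1 P)
  | PAct a u P => PAct a (uliftv k u) (pliftv k P)
  | PPar P Q => PPar (pliftv k P) (pliftv k Q)
  | PSend c u P Q => PSend c (uliftv k u) (pliftv k P) (pliftv k Q)
  | PRecv c P Q => PRecv c (pliftv k.+1 P) (pliftv k Q)
  | PIf f us P Q => PIf f (map (uliftv k) us) (pliftv k P) (pliftv k Q)
  | PVar X => PVar X
  | PFix P => PFix (pliftv k P)
  end.

(* shifts the free process variables of index at least k *)
Fixpoint pliftp (k : nat) (P : proc) : proc :=
  match P with
  | PNil => PNil
  | PDelay P => PDelay (pliftp k P)
  | PLoc P => PLoc (pliftp k P)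
  | PSense s P => PSense s (pliftp k P)
  | PAct a u P => PAct a u (pliftp k P)
  | PPar P Q => PPar (pliftp k P) (pliftp k Q)
  | PSend c u P Q => PSend c u (pliftp k P) (pliftp k Q)
  | PRecv c P Q => PRecv c (pliftp k P) (pliftp k Q)
  | PIf f us P Q => PIf f us (pliftp k P) (pliftp k Q)
  | PVar X => PVar (if k <= X then X.+1 else X)
  | PFix P => PFix (pliftp k.+1 P)
  end.

(* P{T/X}, for X the process variable of index k *)
Fixpoint psubstp (k : nat) (T P : proc) : proc :=
  match P with
  | PNil => PNil
  | PDelay P => PDelay (psubstp k T P)
  | PLoc P => PLoc (psubstp k (pliftv 0 T) P)
  | PSense s P => PSense s (psubstp k (pliftv 0 T) P)
  | PAct a u P => PAct a u (psubstp k T P)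
  | PPar P Q => PPar (psubstp k T P) (psubstp k T Q)
  | PSend c u P Q => PSend c u (psubstp k T P) (psubstp k T Q)
  | PRecv c P Q => PRecv c (psubstp k (pliftv 0 T) P) (psubstp k T Q)
  | PIf f us P Q => PIf f us (psubstp k T P) (psubstp k T Q)
  | PVar X => if X == k then T else PVar (if k < X then X.-1 else X)
  | PFix P => PFix (psubstp k.+1 (pliftp 0 T) P)
  end.

Definition unfold_fix (P : proc) : proc := psubstp 0 (PFix P) P.

(* None on guards with variables *)
Fixpoint uvals (us : seq vterm) : option (seq val) :=
  match us with
  | [::] => Some [::]
  | Val v :: us => omap (cons v) (uvals us)
  | Var _ :: _ => None
  end.

Definition geval (f : seq val -> bool) (us : seq vterm) : option bool :=
  omap f (uvals us).

(** Occurrences *)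

Fixpoint chan_in (c : chan C) (P : proc) : bool :=
  match P with
  | PNil | PVar _ => false
  | PDelay P | PLoc P | PSense _ P | PAct _ _ P | PFix P => chan_in c P
  | PPar P Q | PIf _ _ P Q => chan_in c P || chan_in c Q
  | PSend d _ P Q | PRecv d P Q => [|| d == c, chan_in c P | chan_in c Q]
  end.

Fixpoint sens_in (s : sensor C) (P : proc) : bool :=
  match P with
  | PNil | PVar _ => false
  | PSense t P => (t == s) || sens_in s P
  | PDelay P | PLoc P | PAct _ _ P | PFix P => sens_in s P
  | PPar P Q | PIf _ _ P Q | PSend _ _ P Q | PRecv _ P Q =>
      sens_in s P || sens_in s Q
  end.

Fixpoint act_in (a : actuator C) (P : proc) : bool :=
  match P with
  | PNil | PVar _ => false
  | PAct b _ P => (b == a) || act_in a P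
  | PDelay P | PLoc P | PSense _ P | PFix P => act_in a P
  | PPar P Q | PIf _ _ P Q | PSend _ _ P Q | PRecv _ P Q =>
      act_in a P || act_in a Q
  end.

(* P has a subterm that is a timed communication *)
Fixpoint has_comm (P : proc) : bool :=
  match P with
  | PNil | PVar _ => false
  | PSend _ _ _ _ | PRecv _ _ _ => true
  | PDelay P | PLoc P | PSense _ P | PAct _ _ P | PFix P => has_comm P
  | PPar P Q | PIf _ _ P Q => has_comm P || has_comm Q
  end.

(* P has a subterm a!v.P1 *)
Fixpoint has_act (P : proc) : bool :=
  match P with
  | PNil | PVar _ => false
  | PAct _ _ _ => true
  | PDelay P | PLoc P | PSense _ P | PFix P => has_act P
  | PPar P Q | PIf _ _ P Q | PSend _ _ P Q | PRecv _ P Q =>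
      has_act P || has_act Q
  end.

(* P has a subterm @(x).Q *)
Fixpoint has_loc (P : proc) : bool :=
  match P with
  | PNil | PVar _ => false
  | PLoc _ => true
  | PDelay P | PSense _ P | PAct _ _ P | PFix P => has_loc P
  | PPar P Q | PIf _ _ P Q | PSend _ _ P Q | PRecv _ P Q =>
      has_loc P || has_loc Q
  end.

Fixpoint chan_free (c : chan C) (M : net) : bool :=
  match M with
  | NNil => false
  | NNode _ _ P _ _ => chan_in c P
  | NPar M N => chan_free c M || chan_free c N
  | NRes d M => (d != c) && chan_free c M
  end.

(* free or bound occurrence *)
Fixpoint chan_occ (c : chan C) (M : net) : bool :=
  match M with
  | NNil => false
  | NNode _ _ P _ _ => chan_in c P
  | NPar M N => chan_occ c M || chan_occ c N
  | NRes d M => (d == c) || chan_occ c M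
  end.

Fixpoint prename (c d : chan C) (P : proc) : proc :=
  match P with
  | PNil => PNil
  | PDelay P => PDelay (prename c d P)
  | PLoc P => PLoc (prename c d P)
  | PSense s P => PSense s (prename c d P)
  | PAct a u P => PAct a u (prename c d P)
  | PPar P Q => PPar (prename c d P) (prename c d Q)
  | PSend e u P Q =>
      PSend (if e == c then d else e) u (prename c d P) (prename c d Q)
  | PRecv e P Q =>
      PRecv (if e == c then d else e) (prename c d P) (prename c d Q)
  | PIf f us P Q => PIf f us (prename c d P) (prename c d Q)
  | PVar X => PVar X
  | PFix P => PFix (prename c d P)
  end.

(* M{d/c}; used only when d does not occur in M *)
Fixpoint nrename (c d : chan C) (M : net) : net :=
  match M with
  | NNil => NNil
  | NNode n J P mu h => NNode n J (prename c d P) mu h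
  | NPar M N => NPar (nrename c d M) (nrename c d N)
  | NRes e M => if e == c then NRes e M else NRes e (nrename c d M)
  end.

(** Well-formedness *)

Definition uscoped (m : nat) (u : vterm) : bool :=
  if u is Var j then j < m else true.

(* free value variables below m, free process variables below p *)
Fixpoint pscoped (m p : nat) (P : proc) : bool :=
  match P with
  | PNil => true
  | PDelay P => pscoped m p P
  | PLoc P | PSense _ P => pscoped m.+1 p P
  | PAct _ u P => uscoped m u && pscoped m p P
  | PPar P Q => pscoped m p P && pscoped m p Q
  | PSend _ u P Q => [&& uscoped m u, pscoped m p P & pscoped m p Q]
  | PRecv _ P Q => pscoped m.+1 p P && pscoped m p Q
  | PIf _ us P Q => [&& all (uscoped m) us, pscoped m p P & pscoped m p Q]
  | PVar X => X < p
  | PFix P => pscoped m p.+1 P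
  end.

Definition pclosed (P : proc) : bool := pscoped 0 0 P.

(* all occurrences in P of the process variable of index k are time-guarded *)
Fixpoint tguarded (k : nat) (P : proc) : bool :=
  match P with
  | PNil | PDelay _ => true
  | PLoc P | PSense _ P | PAct _ _ P => tguarded k P
  | PPar P Q | PIf _ _ P Q => tguarded k P && tguarded k Q
  | PSend _ _ P _ | PRecv _ P _ => tguarded k P
  | PVar X => X != k
  | PFix P => tguarded k.+1 P
  end.

Fixpoint fix_guarded (P : proc) : bool :=
  match P with
  | PNil | PVar _ => true
  | PDelay P | PLoc P | PSense _ P | PAct _ _ P => fix_guarded P
  | PPar P Q | PIf _ _ P Q | PSend _ _ P Q | PRecv _ P Q =>
      fix_guarded P && fix_guarded Q
  | PFix P => tguarded 0 P && fix_guarded P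
  end.

Fixpoint has_name (n : nodename C) (M : net) : bool :=
  match M with
  | NNil => false
  | NNode m _ _ _ _ => m == n
  | NPar M N => has_name n M || has_name n N
  | NRes _ M => has_name n M
  end.

(* some node of M has x in the domain of its interface *)
Fixpoint defines (x : (sensor C + actuator C)%type) (M : net) : bool :=
  match M with
  | NNil => false
  | NNode _ J _ _ _ => isSome (J x)
  | NPar M N => defines x M || defines x N
  | NRes _ M => defines x M
  end.

Fixpoint wf (M : net) : Prop :=
  match M with
  | NNil => True
  | NNode n J P mu h =>
      [/\ pclosed P /\ fix_guarded P,
          forall s, sens_in s P -> isSome (J (inl s)),
          forall a, act_in a P -> isSome (J (inr a))
        & forall s, locdep s -> isSome (J (inl s)) -> mu = Stat]
  | NPar M N =>
      [/\ wf M /\ wf N,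
          forall n, ~ (has_name n M /\ has_name n N),
          forall a, ~ (defines (inr a) M /\ defines (inr a) N)
        & forall s, ~~ locdep s -> ~ (defines (inl s) M /\ defines (inl s) N)]
  | NRes _ M => wf M
  end.

(** Structural congruence *)

Inductive pcong : proc -> proc -> Prop :=
| pcong_refl P : pcong P P
| pcong_sym P Q : pcong P Q -> pcong Q P
| pcong_trans P Q R : pcong P Q -> pcong Q R -> pcong P R
| pcong_parC P Q : pcong (PPar P Q) (PPar Q P)
| pcong_parA P Q R : pcong (PPar (PPar P Q) R) (PPar P (PPar Q R))
| pcong_par0 P : pcong (PPar P PNil) P
| pcong_ift f us P Q : geval f us = Some true -> pcong (PIf f us P Q) P
| pcong_iff f us P Q : geval f us = Some false -> pcong (PIf f us P Q) Q
| pcong_unfold P : pcong (PFix P) (unfold_fix P)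
| pcong_delay P P' : pcong P P' -> pcong (PDelay P) (PDelay P')
| pcong_loc P P' : pcong P P' -> pcong (PLoc P) (PLoc P')
| pcong_sense s P P' : pcong P P' -> pcong (PSense s P) (PSense s P')
| pcong_act a u P P' : pcong P P' -> pcong (PAct a u P) (PAct a u P')
| pcong_par P P' Q Q' :
    pcong P P' -> pcong Q Q' -> pcong (PPar P Q) (PPar P' Q')
| pcong_send c u P P' Q Q' :
    pcong P P' -> pcong Q Q' -> pcong (PSend c u P Q) (PSend c u P' Q')
| pcong_recv c P P' Q Q' :
    pcong P P' -> pcong Q Q' -> pcong (PRecv c P Q) (PRecv c P' Q')
| pcong_if f us P P' Q Q' :
    pcong P P' -> pcong Q Q' -> pcong (PIf f us P Q) (PIf f us P' Q')
| pcong_fix P P' : pcong P P' -> pcong (PFix P) (PFix P').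

Inductive ncong : net -> net -> Prop :=
| ncong_refl M : ncong M M
| ncong_sym M N : ncong M N -> ncong N M
| ncong_trans M N O : ncong M N -> ncong N O -> ncong M O
| ncong_node n I P Q mu h :
    pcong P Q -> ncong (NNode n I P mu h) (NNode n I Q mu h)
| ncong_parC M N : ncong (NPar M N) (NPar N M)
| ncong_parA M N O : ncong (NPar (NPar M N) O) (NPar M (NPar N O))
| ncong_par0 M : ncong (NPar M NNil) M
| ncong_res0 c : ncong (NRes c NNil) NNil
| ncong_resC c d M : ncong (NRes c (NRes d M)) (NRes d (NRes c M))
| ncong_extr c M N :
    ~~ chan_free c M -> ncong (NRes c (NPar M N)) (NPar M (NRes c N))
| ncong_alpha c d M :
    ~~ chan_occ d M -> rng d = rng c ->
    ncong (NRes c M) (NRes d (nrename c d M))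
| ncong_par M M' N N' :
    ncong M M' -> ncong N N' -> ncong (NPar M N) (NPar M' N')
| ncong_res c M M' : ncong M M' -> ncong (NRes c M) (NRes c M').

(** Intensional semantics *)

(* The rules for sigma have negative premises about tau, and no rule for the
   other labels depends on sigma.  The relation is therefore stratified: first
   the transitions with a label other than sigma, then those labelled sigma. *)

Inductive plabel :=
| LTau
| LOut of chan C & val
| LIn of chan C & val
| LAt of loc C
| LSense of sensor C & val
| LAct of actuator C & val.

Inductive pstep : proc -> plabel -> proc -> Prop :=
| pstep_out c v P Q : pstep (PSend c (Val v) P Q) (LOut c v) P
| pstep_in c v P Q : pstep (PRecv c P Q) (LIn c v) (psubst 0 v P)
| pstep_sense s v P : pstep (PSense s P) (LSense s v) (psubst 0 v P)
| pstep_act a v P : pstep (PAct a (Val v) P) (LAct a v) P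
| pstep_at h P : pstep (PLoc P) (LAt h) (psubst 0 (VLoc h) P)
| pstep_coml c v P P' Q Q' :
    pstep P (LOut c v) P' -> pstep Q (LIn c v) Q' -> rng c = RInt ->
    pstep (PPar P Q) LTau (PPar P' Q')
| pstep_comr c v P P' Q Q' :
    pstep P (LOut c v) P' -> pstep Q (LIn c v) Q' -> rng c = RInt ->
    pstep (PPar Q P) LTau (PPar Q' P')
| pstep_parl l P P' Q : pstep P l P' -> pstep (PPar P Q) l (PPar P' Q)
| pstep_parr l P P' Q : pstep P l P' -> pstep (PPar Q P) l (PPar Q P')
| pstep_fix l P Q : pstep (unfold_fix P) l Q -> pstep (PFix P) l Q
| pstep_ift l f us P P' Q :
    geval f us = Some true -> pstep P l P' -> pstep (PIf f us P Q) l P'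
| pstep_iff l f us P Q Q' :
    geval f us = Some false -> pstep Q l Q' -> pstep (PIf f us P Q) l Q'.

Inductive ptick : proc -> proc -> Prop :=
| ptick_nil : ptick PNil PNil
| ptick_delay P : ptick (PDelay P) P
| ptick_send c u P Q : ptick (PSend c u P Q) Q
| ptick_recv c P Q : ptick (PRecv c P Q) Q
| ptick_par P P' Q Q' :
    ptick P P' -> ptick Q Q' -> ~ (exists R, pstep (PPar P Q) LTau R) ->
    ptick (PPar P Q) (PPar P' Q')
| ptick_fix P Q : ptick (unfold_fix P) Q -> ptick (PFix P) Q
| ptick_ift f us P P' Q :
    geval f us = Some true -> ptick P P' -> ptick (PIf f us P Q) P'
| ptick_iff f us P Q Q' :
    geval f us = Some false -> ptick Q Q' -> ptick (PIf f us P Q) Q'.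

Inductive nlabel :=
| NTau
| NAct of actuator C
| NOut of chan C & val & loc C
| NIn of chan C & val & loc C.

Definition label_chan (l : nlabel) : option (chan C) :=
  match l with
  | NTau | NAct _ => None
  | NOut c _ _ | NIn c _ _ => Some c
  end.

Inductive nstep : net -> nlabel -> net -> Prop :=
| nstep_pos n I P P' mu h :
    pstep P (LAt h) P' -> nstep (NNode n I P mu h) NTau (NNode n I P' mu h)
| nstep_sense n I P P' mu h s v :
    I (inl s) = Some v -> pstep P (LSense s v) P' ->
    nstep (NNode n I P mu h) NTau (NNode n I P' mu h)
| nstep_actunc n I P P' mu h a v :
    I (inr a) = Some v -> pstep P (LAct a v) P' ->
    nstep (NNode n I P mu h) NTau (NNode n I P' mu h)
| nstep_actchg n I P P' mu h a v w :
    I (inr a) = Some w -> w <> v -> pstep P (LAct a v) P' ->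
    nstep (NNode n I P mu h) (NAct a) (NNode n (iupd I (inr a) v) P' mu h)
| nstep_loccom n I P P' mu h :
    pstep P LTau P' -> nstep (NNode n I P mu h) NTau (NNode n I P' mu h)
| nstep_out n I P P' mu h c v :
    pstep P (LOut c v) P' -> rng c <> RInt ->
    nstep (NNode n I P mu h) (NOut c v h) (NNode n I P' mu h)
| nstep_in n I P P' mu h c v :
    pstep P (LIn c v) P' -> rng c <> RInt ->
    nstep (NNode n I P mu h) (NIn c v h) (NNode n I P' mu h)
| nstep_coml M M' N N' c v h k :
    nstep M (NOut c v k) M' -> nstep N (NIn c v h) N' ->
    within (dist h k) (rng c) -> nstep (NPar M N) NTau (NPar M' N')
| nstep_comr M M' N N' c v h k :
    nstep M (NOut c v k) M' -> nstep N (NIn c v h) N' ->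
    within (dist h k) (rng c) -> nstep (NPar N M) NTau (NPar N' M')
| nstep_parl l M M' N : nstep M l M' -> nstep (NPar M N) l (NPar M' N)
| nstep_parr l M M' N : nstep M l M' -> nstep (NPar N M) l (NPar N M')
| nstep_res l c M N :
    nstep M l N -> label_chan l <> Some c -> nstep (NRes c M) l (NRes c N).

Inductive ntick : net -> net -> Prop :=
| ntick_stat n I P P' h :
    ptick P P' -> ~ (exists O, nstep (NNode n I P Stat h) NTau O) ->
    ntick (NNode n I P Stat h) (NNode n I P' Stat h)
| ntick_mob n I P P' h k :
    ptick P P' -> ~ (exists O, nstep (NNode n I P Mob h) NTau O) ->
    dist h k <= delta C ->
    ntick (NNode n I P Mob h) (NNode n I P' Mob k)
| ntick_nil : ntick NNil NNil
| ntick_par M M' N N' :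
    ntick M M' -> ntick N N' -> ~ (exists O, nstep (NPar M N) NTau O) ->
    ntick (NPar M N) (NPar M' N')
| ntick_res c M N : ntick M N -> ntick (NRes c M) (NRes c N).

(** Extensional semantics *)

Definition barb (M : net) (a : actuator C) (v : val) (h : loc C) : Prop :=
  exists gs n I P mu M',
    ncong M (foldr NRes (NPar (NNode n I P mu h) M') gs) /\
    I (inr a) = Some v.

(* M[s@h |-> v] *)
Fixpoint nupd (s : sensor C) (h : loc C) (v : val) (M : net) : net :=
  match M with
  | NNil => NNil
  | NNode n J P mu k =>
      NNode n (if (k == h) && isSome (J (inl s)) then iupd J (inl s) v else J)
        P mu k
  | NPar M N => NPar (nupd s h v M) (nupd s h v N)
  | NRes c M => NRes c (nupd s h v M)
  end.

Inductive elabel :=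
| ETau
| ESigma
| EAct of actuator C
| EOut of chan C & val & loc C
| EIn of chan C & val & loc C
| ESense of sensor C & val & loc C
| EBarb of actuator C & val & loc C.

Inductive estep : net -> elabel -> net -> Prop :=
| estep_tau M M' : nstep M NTau M' -> estep M ETau M'
| estep_sigma M M' : ntick M M' -> estep M ESigma M'
| estep_act M M' a : nstep M (NAct a) M' -> estep M (EAct a) M'
| estep_out M M' c v h k :
    nstep M (NOut c v h) M' -> within (dist h k) (rng c) ->
    estep M (EOut c v k) M'
| estep_in M M' c v h k :
    nstep M (NIn c v h) M' -> within (dist k h) (rng c) ->
    estep M (EIn c v k) M'
| estep_sense M s v h : sdom s v -> estep M (ESense s v h) (nupd s h v M)
| estep_barb M a v h : barb M a v h -> estep M (EBarb a v h) M.

Definition taus : net -> net -> Prop :=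
  clos_refl_trans net (fun M N => estep M ETau N).

Definition weak (M : net) (l : elabel) (N : net) : Prop :=
  exists M1 M2, [/\ taus M M1, estep M1 l M2 & taus M2 N].

Definition weakhat (M : net) (l : elabel) (N : net) : Prop :=
  match l with ETau => taus M N | _ => weak M l N end.

(* Bisimulations and expansions are relations over well-formed networks. *)

Definition bisimulation (R : net -> net -> Prop) : Prop :=
  [/\ forall M N, R M N -> wf M /\ wf N,
      forall M N, R M N -> R N M
    & forall M N l M', R M N -> estep M l M' ->
        exists2 N', weakhat N l N' & R M' N'].

Definition bisimilar (M N : net) : Prop :=
  exists2 R : net -> net -> Prop, bisimulation R & R M N.

Definition expansion (R : net -> net -> Prop) : Prop :=
  [/\ forall M N, R M N -> wf M /\ wf N,
      forall M N l M', R M N -> estep M l M' ->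
        exists2 N', estep N l N' \/ (l = ETau /\ N' = N) & R M' N'
    & forall M N l N', R M N -> estep N l N' ->
        exists2 M', weak M l M' & R M' N'].

Definition expands (M N : net) : Prop :=
  exists2 R : net -> net -> Prop, expansion R & R M N.

End CaIT.

Arguments PNil {C}.
Arguments PVar {C} _.
Arguments Var {C} _.
Arguments NNil {C}.
Arguments iface0 {C} _.

(* Main.v *)
(** In (1)-(4) the left-hand network reaches the right-hand one by a tau-step
    that nothing else can disturb: while it is pending time cannot pass, and
    the context moves in the same way before and after it.  So the pending
    pairs together with the identity form an expansion.

    In (5) the only visible activity of the process is the passage of time.
    Time-guardedness of recursion makes instantaneous activity terminate, and
    a process with nothing instantaneous left to do can let time pass, so every
    tick of [nil] is answered after finitely many tau-steps.  In (6) and (7)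
    the two networks move in lockstep. *)

Require Import Defs.
From mathcomp Require Import all_boot.
From mathcomp Require Import zify.
From Stdlib Require Import Relations.

Set Implicit Arguments.
Unset Strict Implicit.
Unset Printing Implicit Defensive.

(** * Occurrences of prefixes *)

(** The transition rules never appeal to structural congruence, so each relation can describe its
    networks by an explicit syntactic shape whose context process and interface vary, and the moves
    are found by inversion. Congruence returns only through barbs, where it is traded for an
    invariant defined by recursion on the network. Two things need care. The side conditions say
    that some name or prefix does not occur, and they must survive every later move of the context;
    transitions only instantiate, discard or unfold existing code, so absence of any kind of prefix
    is preserved. The rules for time have negative premises: on the left of (1)-(4) these make the
    clause for ticks vacuous, whereas in (5)-(7) an answering node may tick only after it has been
    shown to have no tau-step. In (5) this rules out induction on syntax, because unfolding a
    recursion makes a process larger. *)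

Inductive prefix (C : cait) :=
| KLoc
| KSense of sensor C
| KAct of actuator C
| KSend of chan C
| KRecv of chan C.
Arguments KLoc {C}.

(** Indexing by an arbitrary predicate [f] lets one preservation proof serve all six occurrence
    tests used by the laws and by well-formedness. *)
Fixpoint has_prefix {C : cait} (f : prefix C -> bool) (P : proc C) : bool :=
  match P with
  | PNil | PVar _ => false
  | PDelay P | PFix P => has_prefix f P
  | PLoc P => f KLoc || has_prefix f P
  | PSense s P => f (KSense s) || has_prefix f P
  | PAct a _ P => f (KAct a) || has_prefix f P
  | PPar P Q | PIf _ _ P Q => has_prefix f P || has_prefix f Q
  | PSend c _ P Q => [|| f (KSend c), has_prefix f P | has_prefix f Q]
  | PRecv c P Q => [|| f (KRecv c), has_prefix f P | has_prefix f Q]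
  end.

Definition on_chan {C : cait} (c : chan C) (k : prefix C) : bool :=
  match k with KSend d | KRecv d => d == c | _ => false end.
Definition on_sens {C : cait} (s : sensor C) (k : prefix C) : bool :=
  if k is KSense t then t == s else false.
Definition on_act {C : cait} (a : actuator C) (k : prefix C) : bool :=
  if k is KAct b then b == a else false.
Definition is_comm {C : cait} (k : prefix C) : bool :=
  match k with KSend _ | KRecv _ => true | _ => false end.
Definition is_act {C : cait} (k : prefix C) : bool :=
  if k is KAct _ then true else false.
Definition is_loc {C : cait} (k : prefix C) : bool :=
  if k is KLoc then true else false.

Lemma chan_inE (C : cait) (c : chan C) P : chan_in c P = has_prefix (on_chan c) P.
Proof. by elim: P => //= [P -> Q ->|d _ P -> Q ->|d P -> Q ->|_ _ P -> Q ->]. Qed.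

Lemma sens_inE (C : cait) (s : sensor C) P : sens_in s P = has_prefix (on_sens s) P.
Proof.
by elim: P => //= [t P ->|P -> Q ->|d _ P -> Q ->|d P -> Q ->|_ _ P -> Q ->].
Qed.

Lemma act_inE (C : cait) (a : actuator C) P : act_in a P = has_prefix (on_act a) P.
Proof.
by elim: P => //= [b _ P ->|P -> Q ->|d _ P -> Q ->|d P -> Q ->|_ _ P -> Q ->].
Qed.

Lemma has_commE (C : cait) (P : proc C) : has_comm P = has_prefix is_comm P.
Proof. by elim: P => //= [P -> Q ->|_ _ P -> Q ->]. Qed.

Lemma has_actE (C : cait) (P : proc C) : has_act P = has_prefix is_act P.
Proof.
by elim: P => //= [P -> Q ->|d _ P -> Q ->|d P -> Q ->|_ _ P -> Q ->].
Qed.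

Lemma has_locE (C : cait) (P : proc C) : has_loc P = has_prefix is_loc P.
Proof.
by elim: P => //= [P -> Q ->|d _ P -> Q ->|d P -> Q ->|_ _ P -> Q ->].
Qed.

Lemma has_prefix_sub (C : cait) (f g : prefix C -> bool) P :
  subpred f g -> has_prefix f P -> has_prefix g P.
Proof.
move=> fg; elim: P => //= [P IH|s P IH|a u P IH|P IHP Q IHQ|c u P IHP Q IHQ|
  c P IHP Q IHQ|g' us P IHP Q IHQ].
- by case/orP=> [/fg|/IH] ->; rewrite ?orbT.
- by case/orP=> [/fg|/IH] ->; rewrite ?orbT.
- by case/orP=> [/fg|/IH] ->; rewrite ?orbT.
- by case/orP=> [/IHP|/IHQ] ->; rewrite ?orbT.
- by case/or3P=> [/fg|/IHP|/IHQ] ->; rewrite ?orbT.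
- by case/or3P=> [/fg|/IHP|/IHQ] ->; rewrite ?orbT.
- by case/orP=> [/IHP|/IHQ] ->; rewrite ?orbT.
Qed.

Lemma has_prefix_psubst (C : cait) (f : prefix C -> bool) P k v :
  has_prefix f (psubst k v P) = has_prefix f P.
Proof.
by elim: P k => /= [|P IH|P IH|s P IH|a u P IH|P IHP Q IHQ|c u P IHP Q IHQ|
  c P IHP Q IHQ|g us P IHP Q IHQ|X|P IH] k; rewrite ?IH ?IHP ?IHQ.
Qed.

Lemma has_prefix_pliftv (C : cait) (f : prefix C -> bool) P k :
  has_prefix f (pliftv k P) = has_prefix f P.
Proof.
by elim: P k => /= [|P IH|P IH|s P IH|a u P IH|P IHP Q IHQ|c u P IHP Q IHQ|
  c P IHP Q IHQ|g us P IHP Q IHQ|X|P IH] k; rewrite ?IH ?IHP ?IHQ.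
Qed.

Lemma has_prefix_pliftp (C : cait) (f : prefix C -> bool) P k :
  has_prefix f (pliftp k P) = has_prefix f P.
Proof.
by elim: P k => /= [|P IH|P IH|s P IH|a u P IH|P IHP Q IHQ|c u P IHP Q IHQ|
  c P IHP Q IHQ|g us P IHP Q IHQ|X|P IH] k; rewrite ?IH ?IHP ?IHQ.
Qed.

Lemma has_prefix_psubstp (C : cait) (f : prefix C -> bool) P k T :
  has_prefix f (psubstp k T P) -> has_prefix f P || has_prefix f T.
Proof.
elim: P k T => /= [|P IH|P IH|s P IH|a u P IH|P IHP Q IHQ|c u P IHP Q IHQ|
  c P IHP Q IHQ|g us P IHP Q IHQ|X|P IH] k T //.
- exact: IH.
- by case/orP=> [->//|/IH]; rewrite has_prefix_pliftv -orbA => ->; rewrite orbT.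
- by case/orP=> [->//|/IH]; rewrite has_prefix_pliftv -orbA => ->; rewrite orbT.
- by case/orP=> [->//|/IH]; rewrite -orbA => ->; rewrite orbT.
- by case/orP=> [/IHP|/IHQ] /orP[] -> //; rewrite ?orbT.
- by case/or3P=> [->//|/IHP|/IHQ] /orP[] -> //; rewrite ?orbT.
- case/or3P=> [->//|/IHP|/IHQ]; rewrite ?has_prefix_pliftv;
  by case/orP=> -> //; rewrite ?orbT.
- by case/orP=> [/IHP|/IHQ] /orP[] -> //; rewrite ?orbT.
- by case: eqP.
- by move/IH; rewrite has_prefix_pliftp.
Qed.

Lemma has_prefix_unfold (C : cait) (f : prefix C -> bool) P :
  has_prefix f (unfold_fix P) -> has_prefix f P.
Proof. by move/has_prefix_psubstp => /= /orP[]. Qed.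

Lemma has_prefix_pstep (C : cait) (f : prefix C -> bool) P l P' :
  pstep P l P' -> has_prefix f P' -> has_prefix f P.
Proof.
elim=> //= {P l P'} [c v P Q ->|c v P Q|s v P|a v P ->|h P|
  c v P P' Q Q' _ IHP _ IHQ _|c v P P' Q Q' _ IHP _ IHQ _|
  l P P' Q _ IH|l P P' Q _ IH|l P Q _ IH|l g us P P' Q _ _ IH|
  l g us P Q Q' _ _ IH]; rewrite ?has_prefix_psubst ?orbT //.
- by move=> ->; rewrite orbT.
- by move=> ->; rewrite orbT.
- by move=> ->; rewrite orbT.
- by case/orP=> [/IHP|/IHQ] ->; rewrite ?orbT.
- by case/orP=> [/IHQ|/IHP] ->; rewrite ?orbT.
- by case/orP=> [/IH|] ->; rewrite ?orbT.
- by case/orP=> [|/IH] ->; rewrite ?orbT.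
- by move/IH/has_prefix_unfold.
- by move/IH ->.
- by move/IH ->; rewrite orbT.
Qed.

Lemma has_prefix_ptick (C : cait) (f : prefix C -> bool) P P' :
  ptick P P' -> has_prefix f P' -> has_prefix f P.
Proof.
elim=> //= {P P'} [c u P Q ->|c P Q ->|P P' Q Q' _ IHP _ IHQ _|P Q _ IH|
  g us P P' Q _ _ IH|g us P Q Q' _ _ IH]; rewrite ?orbT //.
- by case/orP=> [/IHP|/IHQ] ->; rewrite ?orbT.
- by move/IH/has_prefix_unfold.
- by move/IH ->.
- by move/IH ->; rewrite orbT.
Qed.

(** A synchronisation inside a process consumes two prefixes but its label names neither, so [LTau]
    has no prefix here and is treated separately in [pstep_tau_comm]. *)
Definition label_prefix {C : cait} (l : plabel C) : option (prefix C) :=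
  match l with
  | LTau => None
  | LOut c _ => Some (KSend c)
  | LIn c _ => Some (KRecv c)
  | LAt _ => Some KLoc
  | LSense s _ => Some (KSense s)
  | LAct a _ => Some (KAct a)
  end.

Lemma pstep_prefix (C : cait) (f : prefix C -> bool) P l P' :
  pstep P l P' -> oapp f false (label_prefix l) -> has_prefix f P.
Proof.
elim=> //= {P l P'} [c v P Q ->|c v P Q ->|s v P ->|a v P ->|h P ->|
  l P P' Q _ IH /IH ->|l P P' Q _ IH /IH ->|l P Q _ IH /IH|
  l g us P P' Q _ _ IH /IH ->|l g us P Q Q' _ _ IH /IH ->] //;
  rewrite ?orbT //.
exact: has_prefix_unfold.
Qed.

(** * Well-formed processes *)

Lemma uliftv_scoped (C : cait) m k (u : vterm C) :
  uscoped m u -> m <= k -> uliftv k u = u.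
Proof. by case: u => //= j jm mk; rewrite leqNgt (leq_trans jm mk). Qed.

Lemma map_uliftv_scoped (C : cait) m k (us : seq (vterm C)) :
  all (uscoped m) us -> m <= k -> map (uliftv k) us = us.
Proof.
move=> + mk; elim: us => //= u us IH /andP[/uliftv_scoped -> //].
by move/IH ->.
Qed.

(** In a closed network only closed recursions are unfolded, so the lifts that [psubstp] applies to
    the substituted term act as the identity. This spares all commutation lemmas between lifting and
    substitution. *)
Lemma pliftv_scoped (C : cait) m p k (P : proc C) :
  pscoped m p P -> m <= k -> pliftv k P = P.
Proof.
elim: P m p k => /= [|P IH|P IH|s P IH|a u P IH|P IHP Q IHQ|c u P IHP Q IHQ|
  c P IHP Q IHQ|g us P IHP Q IHQ|X|P IH] m p k //.
- by move=> /IH e mk; rewrite e.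
- by move=> /IH e mk; rewrite e.
- by move=> /IH e mk; rewrite e.
- by case/andP=> /uliftv_scoped eu /IH e mk; rewrite e ?eu.
- by case/andP=> /IHP eP /IHQ eQ mk; rewrite eP ?eQ.
- by case/and3P=> /uliftv_scoped eu /IHP eP /IHQ eQ mk; rewrite eP ?eQ ?eu.
- by case/andP=> /IHP eP /IHQ eQ mk; rewrite eP ?eQ.
- case/and3P=> /map_uliftv_scoped eu /IHP eP /IHQ eQ mk.
  by rewrite eP ?eQ ?eu.
- by move=> /IH e mk; rewrite e.
Qed.

Lemma pliftp_scoped (C : cait) m p k (P : proc C) :
  pscoped m p P -> p <= k -> pliftp k P = P.
Proof.
elim: P m p k => /= [|P IH|P IH|s P IH|a u P IH|P IHP Q IHQ|c u P IHP Q IHQ|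
  c P IHP Q IHQ|g us P IHP Q IHQ|X|P IH] m p k //.
- by move=> /IH e pk; rewrite e.
- by move=> /IH e pk; rewrite e.
- by move=> /IH e pk; rewrite e.
- by case/andP=> _ /IH e pk; rewrite e.
- by case/andP=> /IHP eP /IHQ eQ pk; rewrite eP ?eQ.
- by case/and3P=> _ /IHP eP /IHQ eQ pk; rewrite eP ?eQ.
- by case/andP=> /IHP eP /IHQ eQ pk; rewrite eP ?eQ.
- by case/and3P=> _ /IHP eP /IHQ eQ pk; rewrite eP ?eQ.
- by move=> Xp pk; rewrite leqNgt (leq_trans Xp pk).
- by move=> /IH e pk; rewrite e.
Qed.

Lemma pscoped_weaken (C : cait) m p m' p' (P : proc C) :
  pscoped m p P -> m <= m' -> p <= p' -> pscoped m' p' P.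
Proof.
have uw n n' (u : vterm C) : n <= n' -> uscoped n u -> uscoped n' u.
  by case: u => //= j nn' /leq_trans -> .
elim: P m p m' p' => /= [|P IH|P IH|s P IH|a u P IH|P IHP Q IHQ|
  c u P IHP Q IHQ|c P IHP Q IHQ|g us P IHP Q IHQ|X|P IH] m p m' p' //.
- exact: IH.
- by move=> /IH e mm pp; apply: e.
- by move=> /IH e mm pp; apply: e.
- by case/andP=> /uw eu /IH e mm pp; rewrite eu ?e.
- by case/andP=> /IHP eP /IHQ eQ mm pp; rewrite eP ?eQ.
- by case/and3P=> /uw eu /IHP eP /IHQ eQ mm pp; rewrite eu ?eP ?eQ.
- by case/andP=> /IHP eP /IHQ eQ mm pp; rewrite eP ?eQ.
- case/and3P=> su /IHP eP /IHQ eQ mm pp; rewrite eP ?eQ // !andbT.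
  by apply: sub_all su => u; apply: uw.
- by move=> Xp _; apply: leq_trans.
- by move=> /IH e mm pp; apply: e.
Qed.

Lemma usubst_scoped (C : cait) m k v (u : vterm C) :
  uscoped m.+1 u -> k <= m -> uscoped m (usubst k v u).
Proof. by case: u => //= j; case: eqP => //= jk; case: (ltnP k j); lia. Qed.

Lemma psubst_scoped (C : cait) m p k v (P : proc C) :
  pscoped m.+1 p P -> k <= m -> pscoped m p (psubst k v P).
Proof.
elim: P m p k => /= [|P IH|P IH|s P IH|a u P IH|P IHP Q IHQ|c u P IHP Q IHQ|
  c P IHP Q IHQ|g us P IHP Q IHQ|X|P IH] m p k //.
- exact: IH.
- by move=> /IH e mk; rewrite e.
- by move=> /IH e mk; rewrite e.
- by case/andP=> su /IH e mk; rewrite e ?usubst_scoped.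
- by case/andP=> /IHP eP /IHQ eQ mk; rewrite eP ?eQ.
- by case/and3P=> su /IHP eP /IHQ eQ mk; rewrite eP ?eQ ?usubst_scoped.
- by case/andP=> /IHP eP /IHQ eQ mk; rewrite eP ?eQ.
- case/and3P=> su /IHP eP /IHQ eQ mk; rewrite eP ?eQ // !andbT all_map.
  by apply: sub_all su => u /= su; apply: usubst_scoped.
- by move=> /IH e mk; rewrite e.
Qed.

Lemma psubstp_scoped (C : cait) m p k (T P : proc C) :
  pclosed T -> pscoped m p.+1 P -> k <= p -> pscoped m p (psubstp k T P).
Proof.
move=> cT; have eTv := pliftv_scoped cT (leqnn 0).
have eTp := pliftp_scoped cT (leqnn 0).
elim: P m p k => /= [|P IH|P IH|s P IH|a u P IH|P IHP Q IHQ|c u P IHP Q IHQ|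
  c P IHP Q IHQ|g us P IHP Q IHQ|X|P IH] m p k; rewrite ?eTv ?eTp //.
- exact: IH.
- by move=> /IH e mk; rewrite e.
- by move=> /IH e mk; rewrite e.
- by case/andP=> -> /IH e mk; rewrite e.
- by case/andP=> /IHP eP /IHQ eQ mk; rewrite eP ?eQ.
- by case/and3P=> -> /IHP eP /IHQ eQ mk; rewrite eP ?eQ.
- by case/andP=> /IHP eP /IHQ eQ mk; rewrite eP ?eQ.
- by case/and3P=> -> /IHP eP /IHQ eQ mk; rewrite eP ?eQ.
- move=> Xp kp; case: eqP => [_|] /=; first exact: pscoped_weaken cT _ _.
  by case: (ltnP k X); lia.
- by move=> /IH e mk; rewrite e.
Qed.

Lemma unfold_fix_closed (C : cait) (P : proc C) :
  pclosed (PFix P) -> pclosed (unfold_fix P).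
Proof. by move=> cP; apply: psubstp_scoped. Qed.

Lemma tguarded_psubst (C : cait) j k v (P : proc C) :
  tguarded j (psubst k v P) = tguarded j P.
Proof.
by elim: P j k => /= [|P IH|P IH|s P IH|a u P IH|P IHP Q IHQ|c u P IHP Q IHQ|
  c P IHP Q IHQ|g us P IHP Q IHQ|X|P IH] j k; rewrite ?IH ?IHP ?IHQ.
Qed.

Lemma fix_guarded_psubst (C : cait) k v (P : proc C) :
  fix_guarded (psubst k v P) = fix_guarded P.
Proof.
by elim: P k => /= [|P IH|P IH|s P IH|a u P IH|P IHP Q IHQ|c u P IHP Q IHQ|
  c P IHP Q IHQ|g us P IHP Q IHQ|X|P IH] k;
  rewrite ?tguarded_psubst ?IH ?IHP ?IHQ.
Qed.

Lemma tguarded_scoped (C : cait) m p j (P : proc C) :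
  pscoped m p P -> p <= j -> tguarded j P.
Proof.
elim: P m p j => /= [|P IH|P IH|s P IH|a u P IH|P IHP Q IHQ|c u P IHP Q IHQ|
  c P IHP Q IHQ|g us P IHP Q IHQ|X|P IH] m p j //.
- exact: IH.
- exact: IH.
- by case/andP=> _; apply: IH.
- by case/andP=> /IHP eP /IHQ eQ pj; rewrite eP ?eQ.
- by case/and3P=> _ /IHP e _ pj; apply: e.
- by case/andP=> /IHP e _ pj; apply: e.
- by case/and3P=> _ /IHP eP /IHQ eQ pj; rewrite eP ?eQ.
- by move=> Xp pj; lia.
- by move=> /IH e pj; rewrite e.
Qed.

(** The case [j < k] is the one met under an inner recursion: its own variable has index 0, and the
    variable being replaced has been shifted above it. The closed term [T] has no free variable that
    could break the guard. *)
Lemma tguarded_psubstp (C : cait) j k (T P : proc C) :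
  pclosed T -> j < k -> tguarded j P -> tguarded j (psubstp k T P).
Proof.
move=> cT; have eTv := pliftv_scoped cT (leqnn 0).
have eTp := pliftp_scoped cT (leqnn 0).
elim: P j k => /= [|P IH|P IH|s P IH|a u P IH|P IHP Q IHQ|c u P IHP Q IHQ|
  c P IHP Q IHQ|g us P IHP Q IHQ|X|P IH] j k; rewrite ?eTv ?eTp //; auto.
- by move=> jk /andP[/IHP -> // /IHQ ->].
- by move=> jk /andP[/IHP -> // /IHQ ->].
- move=> jk Xj; case: eqP => [_|] /=; first exact: tguarded_scoped cT _.
  by case: (ltnP k X); lia.
Qed.

Lemma fix_guarded_psubstp (C : cait) k (T P : proc C) :
  pclosed T -> fix_guarded T -> fix_guarded P -> fix_guarded (psubstp k T P).
Proof.
move=> cT gT; have eTv := pliftv_scoped cT (leqnn 0).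
have eTp := pliftp_scoped cT (leqnn 0).
elim: P k => /= [|P IH|P IH|s P IH|a u P IH|P IHP Q IHQ|c u P IHP Q IHQ|
  c P IHP Q IHQ|g us P IHP Q IHQ|X|P IH] k; rewrite ?eTv ?eTp //; auto.
- by case/andP=> /IHP -> /IHQ ->.
- by case/andP=> /IHP -> /IHQ ->.
- by case/andP=> /IHP -> /IHQ ->.
- by case/andP=> /IHP -> /IHQ ->.
- by case: eqP.
- by case/andP=> /(tguarded_psubstp cT (ltn0Sn k)) -> /IH ->.
Qed.

Definition pwf {C : cait} (P : proc C) : Prop := pclosed P /\ fix_guarded P.

Lemma pwf_unfold (C : cait) (P : proc C) : pwf (PFix P) -> pwf (unfold_fix P).
Proof.
case=> cP gP; split; first exact: unfold_fix_closed.
by apply: fix_guarded_psubstp => //; case/andP: gP.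
Qed.

Lemma pwf_par (C : cait) (P Q : proc C) : pwf (PPar P Q) <-> pwf P /\ pwf Q.
Proof.
by rewrite /pwf /pclosed /=; split=> [[/andP[-> ->] /andP[-> ->]]|
  [[-> ->] [-> ->]]].
Qed.

Lemma pwf_if (C : cait) g us (P Q : proc C) : pwf (PIf g us P Q) -> pwf P /\ pwf Q.
Proof.
by rewrite /pwf /pclosed /= => -[/and3P[_ -> ->] /andP[-> ->]].
Qed.

Lemma pwf_subst (C : cait) (P : proc C) v :
  pscoped 1 0 P -> fix_guarded P -> pwf (psubst 0 v P).
Proof. by move=> cP gP; split; rewrite ?fix_guarded_psubst ?/pclosed ?psubst_scoped. Qed.

Lemma pwf_pstep (C : cait) (P P' : proc C) l : pstep P l P' -> pwf P -> pwf P'.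
Proof.
elim=> {P l P'} [c v P Q|c v P Q|s v P|a v P|h P|
  c v P P' Q Q' _ IHP _ IHQ _|c v P P' Q Q' _ IHP _ IHQ _|
  l P P' Q _ IH|l P P' Q _ IH|l P Q _ IH|l g us P P' Q _ _ IH|
  l g us P Q Q' _ _ IH].
- by case=> /and3P[_ cP _] /andP[gP _].
- by case=> /andP[cP _] /andP[gP _]; apply: pwf_subst.
- by case=> cP gP; apply: pwf_subst.
- by case.
- by case=> cP gP; apply: pwf_subst.
- by case/pwf_par=> /IHP wP /IHQ wQ; apply/pwf_par.
- by case/pwf_par=> /IHQ wQ /IHP wP; apply/pwf_par.
- by case/pwf_par=> /IH wP wQ; apply/pwf_par.
- by case/pwf_par=> wQ /IH wP; apply/pwf_par.
- by move/pwf_unfold.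
- by case/pwf_if=> /IH.
- by case/pwf_if=> _ /IH.
Qed.

Lemma pwf_ptick (C : cait) (P P' : proc C) : ptick P P' -> pwf P -> pwf P'.
Proof.
elim=> {P P'} [|P|c u P Q|c P Q|P P' Q Q' _ IHP _ IHQ _|P Q _ IH|
  g us P P' Q _ _ IH|g us P Q Q' _ _ IH] //.
- by case=> /and3P[_ _ cQ] /andP[_ gQ].
- by case=> /andP[_ cQ] /andP[_ gQ].
- by case/pwf_par=> /IHP wP /IHQ wQ; apply/pwf_par.
- by move/pwf_unfold.
- by case/pwf_if=> /IH.
- by case/pwf_if=> _ /IH.
Qed.

(** * Urgent weight *)

(* Size of the part of a process that is not time-guarded: unfolding a guarded
   recursion leaves it unchanged, which makes instantaneous activity finite. *)
Fixpoint weight {C : cait} (P : proc C) : nat :=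
  match P with
  | PNil | PDelay _ | PVar _ => 0
  | PLoc P | PSense _ P | PAct _ _ P | PFix P => (weight P).+1
  | PSend _ _ P _ | PRecv _ P _ => (weight P).+1
  | PPar P Q | PIf _ _ P Q => (weight P + weight Q).+1
  end.

Lemma weight_psubst (C : cait) k v (P : proc C) :
  weight (psubst k v P) = weight P.
Proof.
by elim: P k => /= [|P IH|P IH|s P IH|a u P IH|P IHP Q IHQ|c u P IHP Q IHQ|
  c P IHP Q IHQ|g us P IHP Q IHQ|X|P IH] k; rewrite ?IH ?IHP ?IHQ.
Qed.

(** Guardedness confines the replaced variable to bodies of [PDelay] and to timeout branches, which
    are exactly the places that [weight] does not count. *)
Lemma weight_psubstp (C : cait) k (T P : proc C) :
  tguarded k P -> weight (psubstp k T P) = weight P.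
Proof.
elim: P k T => /= [|P IH|P IH|s P IH|a u P IH|P IHP Q IHQ|c u P IHP Q IHQ|
  c P IHP Q IHQ|g us P IHP Q IHQ|X|P IH] k T //.
- by move/IH ->.
- by move/IH ->.
- by move/IH ->.
- by case/andP=> /IHP -> /IHQ ->.
- by move/IHP ->.
- by move/IHP ->.
- by case/andP=> /IHP -> /IHQ ->.
- by case: eqP.
- by move/IH ->.
Qed.

Lemma weight_unfold (C : cait) (P : proc C) :
  pwf (PFix P) -> weight (unfold_fix P) = weight P.
Proof. by case=> _ /andP[gP _]; apply: weight_psubstp. Qed.

(** Every step consumes a counted prefix, a synchronisation consumes two, and the continuation kept
    is the branch that was counted. For a recursion, the unfolding weighs as much as the body, one
    less than the [PFix] itself. *)
Lemma weight_pstep (C : cait) (P P' : proc C) l :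
  pstep P l P' -> pwf P -> weight P' < weight P.
Proof.
elim=> /= {P l P'} [c v P Q|c v P Q|s v P|a v P|h P|
  c v P P' Q Q' _ IHP _ IHQ _|c v P P' Q Q' _ IHP _ IHQ _|
  l P P' Q _ IH|l P P' Q _ IH|l P Q _ IH|l g us P P' Q _ _ IH|
  l g us P Q Q' _ _ IH]; rewrite ?weight_psubst //.
- by case/pwf_par=> /IHP wP /IHQ wQ; lia.
- by case/pwf_par=> /IHQ wQ /IHP wP; lia.
- by case/pwf_par=> /IH wP _; lia.
- by case/pwf_par=> _ /IH wP; lia.
- move=> wP; have := IH (pwf_unfold wP); rewrite weight_unfold //; lia.
- by case/pwf_if=> /IH wP _; lia.
- by case/pwf_if=> _ /IH wQ; lia.
Qed.

(** * Transitions of nodes *)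

(* [fire I h l nl I']: at location [h] with interface [I], a process step [l]
   shows as the network label [nl] and turns the interface into [I']. *)
Inductive fire {C : cait} (I : iface C) (h : loc C) :
  plabel C -> nlabel C -> iface C -> Prop :=
| fire_at : fire I h (LAt h) (NTau C) I
| fire_sense s v : I (inl s) = Some v -> fire I h (LSense s v) (NTau C) I
| fire_actunc a v : I (inr a) = Some v -> fire I h (LAct a v) (NTau C) I
| fire_actchg a v w : I (inr a) = Some w -> w <> v ->
    fire I h (LAct a v) (NAct a) (iupd I (inr a) v)
| fire_tau : fire I h (LTau C) (NTau C) I
| fire_out c v : rng c <> RInt -> fire I h (LOut c v) (NOut c v h) I
| fire_in c v : rng c <> RInt -> fire I h (LIn c v) (NIn c v h) I.

Lemma nstep_fire (C : cait) n (I I' : iface C) P P' mu h l nl :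
  pstep P l P' -> fire I h l nl I' ->
  nstep (NNode n I P mu h) nl (NNode n I' P' mu h).
Proof.
move=> sP fI; case: fI sP.
- exact: nstep_pos.
- by move=> s v; apply: nstep_sense.
- by move=> a v; apply: nstep_actunc.
- by move=> a v w Ia wv; apply: nstep_actchg Ia wv.
- exact: nstep_loccom.
- by move=> c v rc sP; apply: nstep_out.
- by move=> c v rc sP; apply: nstep_in.
Qed.

Lemma nstep_node_inv (C : cait) n (I : iface C) P mu h nl X :
  nstep (NNode n I P mu h) nl X ->
  exists l P' I', [/\ pstep P l P', fire I h l nl I' & X = NNode n I' P' mu h].
Proof.
move=> sX; inversion sX; subst;
  match goal with H : pstep P ?l ?Q |- _ => exists l, Q end;
  eexists; split; eauto; econstructor; eauto.
Qed.

Lemma fire_defined (C : cait) (I I' : iface C) h l nl x :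
  fire I h l nl I' -> isSome (I' x) = isSome (I x).
Proof. by case=> // a v w Ia _; rewrite /iupd; case: eqP => // ->; rewrite Ia. Qed.

Lemma fire_tau_iface (C : cait) (I I' : iface C) h l :
  fire I h l (NTau C) I' -> I' = I.
Proof. by move=> fI; inversion fI. Qed.

Lemma pstep_par_inv (C : cait) (P Q : proc C) l X :
  pstep (PPar P Q) l X ->
  [\/ exists2 P', pstep P l P' & X = PPar P' Q,
      exists2 Q', pstep Q l Q' & X = PPar P Q'
    | l = LTau C /\ exists c v P' Q', [/\ rng c = RInt, X = PPar P' Q' &
        pstep P (LOut c v) P' /\ pstep Q (LIn c v) Q' \/
        pstep P (LIn c v) P' /\ pstep Q (LOut c v) Q']].
Proof.
move=> sX; inversion sX; subst.
- by constructor 3; split=> //; exists c, v, P', Q'; split=> //; left.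
- by constructor 3; split=> //; exists c, v, Q', P'; split=> //; right.
- by constructor 1; exists P'.
- by constructor 2; exists P'.
Qed.

(** The only move belonging to neither component is an internal synchronisation of [A] with [R]. It
    needs a channel of range -1 that occurs in [R] and on which [A] is active, which the first
    hypothesis excludes. *)
Lemma nstep_node_par (C : cait) n (I : iface C) A R mu h nl X :
  (forall c v A', rng c = RInt -> chan_in c R ->
     ~ pstep A (LOut c v) A' /\ ~ pstep A (LIn c v) A') ->
  nstep (NNode n I (PPar A R) mu h) nl X ->
  (exists l A' I', [/\ pstep A l A', fire I h l nl I' &
     X = NNode n I' (PPar A' R) mu h]) \/
  (exists l R' I', [/\ pstep R l R', fire I h l nl I' &
     X = NNode n I' (PPar A R') mu h]).
Proof.
move=> nocom /nstep_node_inv[l [Y [I' [/pstep_par_inv sY fI ->]]]].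
case: sY => [[A' sA ->]|[R' sR ->]|[_ [c [v [A' [R' [rc _ sAR]]]]]]].
- by left; exists l, A', I'.
- by right; exists l, R', I'.
- exfalso; case: sAR => -[sA sR].
    have cR : chan_in c R by rewrite chan_inE (pstep_prefix sR) //= eqxx.
    by case: (nocom c v A' rc cR).
  have cR : chan_in c R by rewrite chan_inE (pstep_prefix sR) //= eqxx.
  by case: (nocom c v A' rc cR).
Qed.

(** * Preservation of well-formedness *)

Lemma has_name_nstep (C : cait) (M M' : net C) l n :
  nstep M l M' -> has_name n M' = has_name n M.
Proof. by elim=> //= *; congruence. Qed.

Lemma defines_nstep (C : cait) (M M' : net C) l x :
  nstep M l M' -> defines x M' = defines x M.
Proof.
elim=> //= [|*|*|*|*]; try congruence.
by move=> n I P P' mu h a v w Ia _ _; rewrite /iupd; case: eqP => // ->; rewrite Ia.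
Qed.

Lemma has_name_ntick (C : cait) (M M' : net C) n :
  ntick M M' -> has_name n M' = has_name n M.
Proof. by elim=> //= *; congruence. Qed.

Lemma defines_ntick (C : cait) (M M' : net C) x :
  ntick M M' -> defines x M' = defines x M.
Proof. by elim=> //= *; congruence. Qed.

Lemma has_name_nupd (C : cait) (M : net C) s h v n :
  has_name n (nupd s h v M) = has_name n M.
Proof. by elim: M => //= *; congruence. Qed.

Lemma nupd_defined (C : cait) (I : iface C) (b : bool) s v x :
  isSome ((if b && isSome (I (inl s)) then iupd I (inl s) v else I) x) =
  isSome (I x).
Proof.
by case: ifP => // /andP[_ Is]; rewrite /iupd; case: eqP => // ->.
Qed.

Lemma defines_nupd (C : cait) (M : net C) s h v x :
  defines x (nupd s h v M) = defines x M.
Proof.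
by elim: M => //= [n I P mu k|M -> N ->] //; rewrite nupd_defined.
Qed.

(** Well-formedness sees the interface only through its domain, and the process only through
    closedness, guardedness and the prefixes that occur. All kinds of moves respect these three. *)
Lemma wf_node_step (C : cait) n n' (I I' : iface C) P P' mu h h' :
  wf (NNode n I P mu h) -> (pwf P -> pwf P') ->
  (forall f, has_prefix f P' -> has_prefix f P) ->
  (forall x, isSome (I' x) = isSome (I x)) ->
  wf (NNode n' I' P' mu h').
Proof.
case=> wP sP aP lP wP' sub eI; split; first exact: wP'.
- by move=> s; rewrite eI sens_inE => /sub; rewrite -sens_inE; apply: sP.
- by move=> a; rewrite eI act_inE => /sub; rewrite -act_inE; apply: aP.
- by move=> s ls; rewrite eI; apply: lP.
Qed.

Lemma wf_node_pstep (C : cait) n (I I' : iface C) P l P' mu h :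
  pstep P l P' -> (forall x, isSome (I' x) = isSome (I x)) ->
  wf (NNode n I P mu h) -> wf (NNode n I' P' mu h).
Proof.
move=> sP eI /wf_node_step; apply=> //; first exact: pwf_pstep sP.
by move=> f; apply: has_prefix_pstep sP.
Qed.

Lemma wf_par_step (C : cait) (M M' N N' : net C) :
  (wf M -> wf M') -> (wf N -> wf N') ->
  (forall n, has_name n M' = has_name n M) ->
  (forall n, has_name n N' = has_name n N) ->
  (forall x, defines x M' = defines x M) ->
  (forall x, defines x N' = defines x N) ->
  wf (NPar M N) -> wf (NPar M' N').
Proof.
move=> wM wN hM hN dM dN [[/wM wM' /wN wN'] hMN aMN sMN].
split=> // [n|a|s ls]; rewrite ?hM ?hN ?dM ?dN; [exact: hMN|exact: aMN|].
exact: sMN.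
Qed.

Lemma wf_nstep (C : cait) (M M' : net C) l : nstep M l M' -> wf M -> wf M'.
Proof.
move=> sM; elim: (sM) => {M M' l sM}.
- by move=> n I P P' mu h sP; apply: wf_node_pstep sP _.
- by move=> n I P P' mu h s v _ sP; apply: wf_node_pstep sP _.
- by move=> n I P P' mu h a v _ sP; apply: wf_node_pstep sP _.
- move=> n I P P' mu h a v w Ia wv sP; apply: wf_node_pstep sP _.
  by move=> x; apply: (fire_defined (h := h)); apply: fire_actchg Ia wv.
- by move=> n I P P' mu h sP; apply: wf_node_pstep sP _.
- by move=> n I P P' mu h c v sP _; apply: wf_node_pstep sP _.
- by move=> n I P P' mu h c v sP _; apply: wf_node_pstep sP _.
- move=> M M' N N' c v h k sM IHM sN IHN _.
  apply: wf_par_step => // x; by [exact: has_name_nstep sM |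
    exact: has_name_nstep sN | exact: defines_nstep sM | exact: defines_nstep sN].
- move=> M M' N N' c v h k sM IHM sN IHN _.
  apply: wf_par_step => // x; by [exact: has_name_nstep sM |
    exact: has_name_nstep sN | exact: defines_nstep sM | exact: defines_nstep sN].
- move=> l M M' N sM IHM; apply: wf_par_step => // x;
    by [exact: has_name_nstep sM | exact: defines_nstep sM].
- move=> l M M' N sM IHM; apply: wf_par_step => // x;
    by [exact: has_name_nstep sM | exact: defines_nstep sM].
- by [].
Qed.

Lemma wf_ntick (C : cait) (M M' : net C) : ntick M M' -> wf M -> wf M'.
Proof.
elim=> {M M'} //.
- move=> n I P P' h tP _ wM; apply: wf_node_step wM _ _ _ => //.
    exact: pwf_ptick tP.
  by move=> f; apply: has_prefix_ptick tP.
- move=> n I P P' h k tP _ _ wM; apply: wf_node_step wM _ _ _ => //.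
    exact: pwf_ptick tP.
  by move=> f; apply: has_prefix_ptick tP.
- move=> M M' N N' tM IHM tN IHN _; apply: wf_par_step => // x;
    by [exact: has_name_ntick tM | exact: has_name_ntick tN |
        exact: defines_ntick tM | exact: defines_ntick tN].
Qed.

Lemma wf_nupd (C : cait) (M : net C) s h v : wf M -> wf (nupd s h v M).
Proof.
elim: M => //= [n I P mu k|M IHM N IHN].
- move=> wM; apply: (@wf_node_step C n n I _ P P mu k k) => //.
  by move=> x; rewrite nupd_defined.
- apply: wf_par_step => // x; by rewrite ?has_name_nupd ?defines_nupd.
Qed.

Lemma wf_estep (C : cait) (M M' : net C) l : estep M l M' -> wf M -> wf M'.
Proof.
case=> // {M M' l} [M M' sM|M M' tM|M M' a sM|M M' c v h k sM _|
  M M' c v h k sM _|M s v h _].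
1,3-5: exact: wf_nstep sM.
- exact: wf_ntick tM.
- exact: wf_nupd.
Qed.

(** * Barbs *)

(** A barb quantifies over all networks congruent to the given one and cannot be inverted directly.
    This recursive form is invariant under congruence; restrictions are transparent to it since they
    bind channels, not actuators. *)
Fixpoint offers {C : cait} (a : actuator C) (v : value (data C) (loc C))
  (h : loc C) (M : net C) : Prop :=
  match M with
  | NNil => False
  | NNode _ J _ _ k => k = h /\ J (inr a) = Some v
  | NPar M N => offers a v h M \/ offers a v h N
  | NRes _ M => offers a v h M
  end.

Lemma offers_nrename (C : cait) (a : actuator C) v h c d M :
  offers a v h (nrename c d M) <-> offers a v h M.
Proof.
elim: M => //= [M IHM N IHN|e M IHM]; first by tauto.
by case: eqP.
Qed.

Lemma offers_ncong (C : cait) (a : actuator C) v h M N :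
  ncong M N -> (offers a v h M <-> offers a v h N).
Proof.
elim=> //= {M N}; try tauto.
by move=> c d M _ _; rewrite offers_nrename.
Qed.

Lemma offers_barb (C : cait) (a : actuator C) v h M :
  barb M a v h -> offers a v h M.
Proof.
case=> [gs [n [I [P [mu [M' [/(offers_ncong a v h) -> Ia]]]]]]].
by elim: gs => //=; left.
Qed.

Lemma barb_node (C : cait) n (I : iface C) P mu h a v :
  I (inr a) = Some v -> barb (NNode n I P mu h) a v h.
Proof.
move=> Ia; exists [::], n, I, P, mu, NNil; split=> //=.
exact/ncong_sym/ncong_par0.
Qed.

Lemma barb_res_par (C : cait) c n m (I J : iface C) P Q mu mu' h k a v l :
  offers a v l (NPar (NNode n I P mu h) (NNode m J Q mu' k)) ->
  barb (NRes c (NPar (NNode n I P mu h) (NNode m J Q mu' k))) a v l.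
Proof.
case=> /= -[<- Ea].
- exists [:: c], n, I, P, mu, (NNode m J Q mu' k); split=> //=.
  exact: ncong_refl.
- exists [:: c], m, J, Q, mu', (NNode n I P mu h); split=> //=.
  exact/ncong_res/ncong_parC.
Qed.

(** * Proof principles *)

Lemma taus_refl (C : cait) (M : net C) : taus M M.
Proof. exact: rt_refl. Qed.

Lemma estep_weakhat (C : cait) (M N : net C) l : estep M l N -> weakhat M l N.
Proof.
move=> sM; have [] : weak M l N /\ (l = ETau C -> taus M N).
  split; first by exists M, N; split=> //; apply: taus_refl.
  by move=> el; subst l; apply: rt_step.
by case: l {sM} => //= _; apply.
Qed.

(* [N] is reached from [M] by a single tau-step, and as long as that step is
   pending the rest of the network can move on both sides alike. *)
Lemma tau_expansion (C : cait) (S : net C -> net C -> Prop) M N :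
  (forall M N, S M N -> wf M /\ nstep M (NTau C) N) ->
  (forall M N l M', S M N -> estep M l M' ->
     (l = ETau C /\ M' = N) \/ exists2 N', estep N l N' & S M' N') ->
  S M N -> expands M N.
Proof.
move=> Stau Sstep SMN; exists (fun M N => S M N \/ M = N /\ wf M); last by left.
split=> {M N SMN}.
- move=> M N [/Stau[wM sM]|[<- wM]] //; split=> //; exact: wf_nstep sM wM.
- move=> M N l M' [SMN|[<- wM]] sM'; last first.
    by exists M'; [left | right; split=> //; apply: wf_estep sM' wM].
  case: (Sstep _ _ _ _ SMN sM') => [[-> ->]|[N' sN SMN']].
    exists N; first by right.
    by right; split=> //; case: (Stau _ _ SMN) => wM /wf_nstep; apply.
  by exists N'; left.
(* A move of [N] is answered by first performing the pending tau-step; from then on the two sides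
   coincide. That step also supplies the tau required when the move is itself a tau. *)
- move=> M N l N' [/Stau[wM sM]|[<- wM]] sN'; exists N'.
  + by exists N, N'; split=> //; [apply/rt_step/estep_tau | apply: taus_refl].
  + by right; split=> //; apply: wf_estep sN' (wf_nstep sM wM).
  + by exists M, N'; split=> //; apply: taus_refl.
  + by right; split=> //; apply: wf_estep sN' wM.
Qed.

Lemma bisimilar_by (C : cait) (S : net C -> net C -> Prop) M N :
  (forall M N, S M N -> wf M /\ wf N) ->
  (forall M N l M', S M N -> estep M l M' ->
     exists2 N', weakhat N l N' & S M' N') ->
  (forall M N l N', S M N -> estep N l N' ->
     exists2 M', weakhat M l M' & S M' N') ->
  S M N -> bisimilar M N.
Proof.
move=> Swf Sl Sr SMN; exists (fun M N => S M N \/ S N M); last by left.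
split=> {M N SMN} [M N|M N|M N l M'].
- by case=> /Swf[].
- by case; [right|left].
- case=> SMN sM; first by have [N' ? ?] := Sl _ _ _ _ SMN sM; exists N'; [|left].
  by have [N' ? ?] := Sr _ _ _ _ SMN sM; exists N'; [|right].
Qed.

(** Common form of the laws for a redex [A] inside one node, with result [B]. The interface and the
    context [R] evolve while the redex is pending: [Inv] is what keeps the step of [A] silent, and
    [f] marks the prefixes that [R] must avoid so as neither to break [Inv] nor to synchronise with
    [A]. Since [A] cannot tick, neither can the node. *)
Lemma node_expansion (C : cait) (f : prefix C -> bool) (Inv : iface C -> Prop)
    (A B : proc C) n mu h I R :
  (forall I R, Inv I -> nstep (NNode n I (PPar A R) mu h) (NTau C)
                              (NNode n I (PPar B R) mu h)) ->
  (forall A', ~ ptick A A') ->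
  (forall l A' I nl I', Inv I -> pstep A l A' -> fire I h l nl I' ->
     [/\ A' = B, nl = NTau C & I' = I]) ->
  (forall c v A', pstep A (LOut c v) A' \/ pstep A (LIn c v) A' ->
     rng c = RInt -> subpred (on_chan c) f) ->
  (forall l I nl I', Inv I -> fire I h l nl I' ->
     ~~ oapp f false (label_prefix l) -> Inv I') ->
  (forall I s v, Inv I -> Inv (iupd I (inl s) v)) ->
  wf (NNode n I (PPar A R) mu h) -> Inv I -> ~~ has_prefix f R ->
  expands (NNode n I (PPar A R) mu h) (NNode n I (PPar B R) mu h).
Proof.
move=> sAB noA stepA comA InvF InvU wM II nR.
pose S M N := exists I R, [/\ wf M, Inv I, ~~ has_prefix f R,
  M = NNode n I (PPar A R) mu h & N = NNode n I (PPar B R) mu h].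
apply: (@tau_expansion _ S); last by exists I, R.
  by move=> M N [J [Q [wMM IJ _ eM eN]]]; subst; split=> //; apply: sAB.
move=> {I R wM II nR} M N l M' [I [R [wM II nR eM eN]]] sM.
have wM' := wf_estep sM wM.
have step nl : nstep M nl M' ->
    (nl = NTau C /\ M' = N) \/ exists2 N', nstep N nl N' & S M' N'.
  subst M N; case/nstep_node_par=> [c v A' rc cR|[k [A' [I' [sA fI eM']]]]|
      [k [R' [I' [sR fI eM']]]]].
  - rewrite chan_inE in cR.
    by split=> sA; move: nR; rewrite (has_prefix_sub _ cR) //;
      apply: comA rc; [left; exact: sA | right; exact: sA].
  - by case: (stepA _ _ _ _ _ II sA fI) => eA -> eI; left; subst.
  - right; exists (NNode n I' (PPar B R') mu h).
      by apply: nstep_fire fI; apply: pstep_parr.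
    exists I', R'; split=> //.
      by apply: InvF II fI _; apply: contra nR; apply: pstep_prefix sR.
    by apply: contra nR; apply: has_prefix_pstep sR.
case: sM wM wM' eM step => {l M M'} [M M' sM|M M' tM|M M' a sM|M M' c v k k' sM d|
  M M' c v k k' sM d|M s v k sv|M a v k bM] wM wM' eM step.
- case: (step _ sM) => [[_ ->]|[N' sN SN]]; first by left.
  by right; exists N'; first exact: estep_tau.
- by subst M; exfalso; inversion tM; subst;
    match goal with H : ptick _ _ |- _ => inversion H; subst end;
    match goal with H : ptick A _ |- _ => exact: noA H end.
- case: (step _ sM) => [[]//|[N' sN SN]].
  by right; exists N'; first exact: estep_act.
- case: (step _ sM) => [[]//|[N' sN SN]].
  by right; exists N'; first exact: estep_out d.
- case: (step _ sM) => [[]//|[N' sN SN]].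
  by right; exists N'; first exact: estep_in d.
- right; exists (nupd s k v N); first exact: estep_sense.
  subst M N; exists (if (h == k) && isSome (I (inl s)) then iupd I (inl s) v else I).
  by exists R; split=> //; case: ifP => // _; apply: InvU.
- right; exists N; last by exists I, R.
  apply: estep_barb; move/offers_barb: bM; subst M N => -[<- Ia].
  exact: barb_node.
Qed.

(** * Progress of time in processes without communication and actuation *)

Lemma pstep_tau_comm (C : cait) (P P' : proc C) l :
  pstep P l P' -> l = LTau C -> has_prefix is_comm P.
Proof.
elim=> //= {P l P'}.
- by move=> c v P P' Q Q' sP _ sQ _ _ _; rewrite (pstep_prefix sP).
- by move=> c v P P' Q Q' sP _ sQ _ _ _; rewrite (pstep_prefix sP) ?orbT.
- by move=> l P P' Q _ IH /IH ->.
- by move=> l P P' Q _ IH /IH ->; rewrite orbT.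
- by move=> l P Q _ IH /IH /has_prefix_unfold.
- by move=> l g us P P' Q _ _ IH /IH ->.
- by move=> l g us P Q Q' _ _ IH /IH ->; rewrite orbT.
Qed.

(** Only timed communications can both wait and act: the other prefixes are either urgent or pure
    delays, and the negative premise of [ptick_par] excludes [LTau]. Hence a process free of
    communications that can tick is already quiet. *)
Lemma ptick_pstep (C : cait) (P P' Q : proc C) l :
  ptick P P' -> pstep P l Q -> exists c v, l = LOut c v \/ l = LIn c v.
Proof.
move=> tP; elim: tP Q => {P P'}.
- by move=> Q sQ; inversion sQ.
- by move=> P Q sQ; inversion sQ.
- by move=> c u P Q Q' sQ; inversion sQ; subst; exists c, v; left.
- by move=> c P Q Q' sQ; inversion sQ; subst; exists c, v; right.
- move=> P P' Q Q' _ IHP _ IHQ nt X sX.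
  case: (pstep_par_inv sX) => [[P1 /IHP]|[Q1 /IHQ]|[lt _]] //.
  by case: nt; exists X; rewrite -lt.
- by move=> P P' _ IH Q sQ; inversion sQ; subst; apply: IH; eassumption.
- by move=> g us P P' Q gt _ IH X sX; inversion sX; subst; [eauto | congruence].
- by move=> g us P Q Q' gt _ IH X sX; inversion sX; subst; [congruence | eauto].
Qed.

Lemma uvals_closed (C : cait) (us : seq (vterm C)) :
  all (uscoped 0) us -> exists vs, uvals us = Some vs.
Proof.
elim: us => [|[v|//] us IH] /=; first by exists [::].
by move/IH=> [vs ->]; exists (v :: vs).
Qed.

(** The induction is on [weight], since the unfolding of a recursion is not a subterm but is
    lighter. Closedness provides values for guards and excludes free variables, and the hypothesis
    on sensors keeps reads from blocking. With no actuation the interface stays [I]. *)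
Lemma progress (C : cait) (I : iface C) h P :
  pwf P -> ~~ has_prefix is_comm P -> ~~ has_prefix is_act P ->
  (forall s, has_prefix (on_sens s) P -> isSome (I (inl s))) ->
  (exists P', ptick P P') \/
  (exists l P', pstep P l P' /\ fire I h l (NTau C) I).
Proof.
have [n] := ubnP (weight P); elim: n P => // n IHn.
case=> /= [|P|P|s P|a u P|P Q|c u P Q|c P Q|g us P Q|X|P] //.
- by move=> *; left; exists PNil; constructor.
- by move=> *; left; exists P; constructor.
- move=> *; right; exists (LAt h); eexists; split; first exact: pstep_at.
  exact: fire_at.
- move=> _ _ _ _ sI; right.
  have /sI : (s == s) || has_prefix (on_sens s) P by rewrite eqxx.
  case Is: (I (inl s)) => [v|//] _.
  exists (LSense s v); eexists; split; first exact: pstep_sense.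
  exact: fire_sense.
- move=> wt /pwf_par[wP wQ] /norP[cP cQ] /norP[aP aQ] sI.
  have := IHn P; have := IHn Q.
  case=> //; [lia | by move=> s sQ; apply: sI; rewrite sQ orbT | | ].
  + move=> [Q' tQ]; case=> //; [lia | by move=> s sP; apply: sI; rewrite sP | | ].
    (* Without communication prefixes there is no [LTau] step, so the negative premise of
       [ptick_par] holds. *)
    * move=> [P' tP]; left; exists (PPar P' Q'); apply: ptick_par => //.
      case=> X /pstep_tau_comm /= /(_ erefl).
      by rewrite (negPf cP) (negPf cQ).
    * by move=> [l [P' [sP fl]]]; right; exists l, (PPar P' Q); split=> //;
        apply: pstep_parl.
  + by move=> [l [Q' [sQ fl]]] _; right; exists l, (PPar P Q'); split=> //;
        apply: pstep_parr.
- move=> wt wPQ /norP[cP cQ] /norP[aP aQ] sI.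
  have [vs evs] : exists vs, uvals us = Some vs.
    by apply: uvals_closed; case: wPQ => /and3P[].
  have [wP wQ] := pwf_if wPQ.
  have gE : geval g us = Some (g vs) by rewrite /geval evs.
  case: (g vs) gE => gE.
  + case: (IHn P) => //; [lia | by move=> s sP; apply: sI; rewrite sP | |].
    * by move=> [P' tP]; left; exists P'; apply: ptick_ift.
    * by move=> [l [P' [sP fl]]]; right; exists l, P'; split=> //; apply: pstep_ift.
  + case: (IHn Q) => //; [lia | by move=> s sP; apply: sI; rewrite sP orbT | |].
    * by move=> [P' tP]; left; exists P'; apply: ptick_iff.
    * by move=> [l [P' [sP fl]]]; right; exists l, P'; split=> //; apply: pstep_iff.
- by move=> _ [].
- move=> wt wP cP aP sI.
  have wU := pwf_unfold wP.
  case: (IHn (unfold_fix P)) => //.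
  + by rewrite weight_unfold.
  + by apply: contra cP; apply: has_prefix_unfold.
  + by apply: contra aP; apply: has_prefix_unfold.
  + by move=> s /has_prefix_unfold; apply: sI.
  + by move=> [P' tP]; left; exists P'; apply: ptick_fix.
  + by move=> [l [P' [sP fl]]]; right; exists l, P'; split=> //; apply: pstep_fix.
Qed.

(** Steps taken by [progress] decrease [weight], so they stop at a process that ticks. The interface
    and the location are kept along the way, so the node can then imitate a tick of the idle node
    from the same place. *)
Lemma settle (C : cait) n (I : iface C) P mu h :
  wf (NNode n I P mu h) -> ~~ has_comm P -> ~~ has_act P ->
  exists P1 P2, [/\ taus (NNode n I P mu h) (NNode n I P1 mu h), ptick P1 P2,
    ~ (exists O, nstep (NNode n I P1 mu h) (NTau C) O),
    wf (NNode n I P1 mu h) & ~~ has_comm P1 /\ ~~ has_act P1].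
Proof.
rewrite has_commE has_actE; have [w] := ubnP (weight P); elim: w P => // w IHw P.
rewrite ltnS => wt wP cP aP.
case: (wP) => pP sP _ _.
case: (@progress _ I h P) => // [s|[P' tP]|[l [P' [sP' fl]]]].
- by rewrite -sens_inE; apply: sP.
- exists P, P'; split=> //; rewrite ?has_commE ?has_actE //; first exact: taus_refl.
  case=> O /nstep_node_inv[l [Q [I' [sQ fl _]]]].
  have [c [v el]] := ptick_pstep tP sQ.
  by move: cP; rewrite (pstep_prefix sQ) //; case: el => ->.
- have wP' : wf (NNode n I P' mu h) by apply: wf_node_pstep sP' _ wP.
  have [] // := IHw P'.
  + by apply: leq_trans (weight_pstep sP' pP) wt.
  + by apply: contra cP; apply: has_prefix_pstep sP'.
  + by apply: contra aP; apply: has_prefix_pstep sP'.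
  move=> P1 [P2 [t1 ? ? ? ?]]; exists P1, P2; split=> //.
  by apply: rt_trans t1; apply/rt_step/estep_tau/nstep_fire; eassumption.
Qed.

(** * Algebraic laws *)

Lemma actuation_expands (C : cait) n (I : iface C) a v P R mu h :
  wf (NNode n I (PPar (PAct a (Val v) P) R) mu h) ->
  I (inr a) = Some v -> ~~ act_in a R ->
  expands (NNode n I (PPar (PAct a (Val v) P) R) mu h)
          (NNode n I (PPar P R) mu h).
Proof.
move=> wM Ia; rewrite act_inE => aR.
(* The write is silent only while the interface holds [v] at [a]. A context that does not mention
   [a] cannot change that entry, and the environment updates only sensors. *)
apply: (node_expansion (f := on_act a) (Inv := fun I => I (inr a) = Some v)) => //.
- move=> J Q Ja; apply: nstep_fire; first exact/pstep_parl/pstep_act.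
  exact: fire_actunc.
- by move=> A' tA; inversion tA.
- by move=> l A' J nl J' Ja sA fJ; inversion sA; subst; inversion fJ; subst=> //;
    congruence.
- by move=> c w A' [] sA; inversion sA.
- move=> l J nl J' Ja fJ; case: fJ => //= b w w' Jb _ ab.
  by rewrite /iupd; case: eqP => // -[eab]; rewrite eab eqxx in ab.
Qed.

(** Locations change only when time passes, and time is blocked by the pending read; hence the
    location read later is still [h], whatever the context does. *)
Lemma position_expands (C : cait) n (I : iface C) P R mu h :
  wf (NNode n I (PPar (PLoc P) R) mu h) ->
  expands (NNode n I (PPar (PLoc P) R) mu h)
          (NNode n I (PPar (psubst 0 (VLoc h) P) R) mu h).
Proof.
move=> wM; apply: (node_expansion (f := xpred0) (Inv := fun=> True)) => //.
- move=> J Q _; apply: nstep_fire; first exact/pstep_parl/pstep_at.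
  exact: fire_at.
- by move=> A' tA; inversion tA.
- by move=> l A' J nl J' _ sA fJ; inversion sA; subst; inversion fJ; subst.
- by move=> c w A' [] sA; inversion sA.
- apply: contraT => /negbNE; elim: R {wM} => //= [P1 IH1 Q1 IH2|
    _ _ P1 IH1 Q1 IH2|_ P1 IH1 Q1 IH2|_ _ P1 IH1 Q1 IH2] /orP[]//.
Qed.

(** With range -1 neither half of the pair shows outside its node, and [R] offers no partner on [c],
    so the pair can only synchronise with itself. This enabled synchronisation also defeats the
    negative premise for time. *)
Lemma local_comm_expands (C : cait) n (I : iface C) c v P S Q T R mu h :
  wf (NNode n I (PPar (PPar (PSend c (Val v) P S) (PRecv c Q T)) R) mu h) ->
  ~~ chan_in c R -> rng c = RInt ->
  expands
    (NNode n I (PPar (PPar (PSend c (Val v) P S) (PRecv c Q T)) R) mu h)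
    (NNode n I (PPar (PPar P (psubst 0 v Q)) R) mu h).
Proof.
move=> wM; rewrite chan_inE => cR rc.
have sA : pstep (PPar (PSend c (Val v) P S) (PRecv c Q T)) (LTau C)
                (PPar P (psubst 0 v Q)).
  by apply: pstep_coml rc; [apply: pstep_out | apply: pstep_in].
have invA l A' : pstep (PPar (PSend c (Val v) P S) (PRecv c Q T)) l A' ->
    l = LTau C /\ A' = PPar P (psubst 0 v Q) \/
    exists w, l = LOut c w \/ l = LIn c w.
  case/pstep_par_inv=> [[P' sP _]|[Q' sQ _]|[-> [d [w [P' [Q' [_ -> sPQ]]]]]]].
  - by right; inversion sP; subst; exists v; left.
  - by right; inversion sQ; subst; eexists; right.
  - by left; split=> //; case: sPQ => -[sP sQ]; inversion sP; subst;
      inversion sQ; subst.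
apply: (node_expansion (f := on_chan c) (Inv := fun=> True)) => //.
- move=> J U _; apply: nstep_fire; first exact: pstep_parl sA.
  exact: fire_tau.
- move=> A' tA; inversion tA; subst.
  by match goal with H : ~ _ |- _ => apply: H; exists (PPar P (psubst 0 v Q)) end.
- move=> l A' J nl J' _ /invA[[-> ->] fJ|[w [->|->]] fJ]; inversion fJ;
  by subst=> //.
- by move=> d w A' [] /invA[[]|[w' []]] // [-> _] _.
Qed.

(** Either the communication of [A] on [c] becomes visible, or [R] moves with a label off [c].
    Quantifying over [B] in the second case lets the same move be replayed once [A] has become its
    continuation. *)
Lemma nstep_chan_node (C : cait) (c : chan C) n (I : iface C) A R mu h nl X :
  (forall l A', pstep A l A' -> exists w, l = LOut c w \/ l = LIn c w) ->
  rng c <> RInt -> ~~ chan_in c R ->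
  nstep (NNode n I (PPar A R) mu h) nl X ->
  (exists l A', [/\ pstep A l A', fire I h l nl I &
     X = NNode n I (PPar A' R) mu h]) \/
  (exists I' R', [/\ X = NNode n I' (PPar A R') mu h, ~~ chan_in c R',
     label_chan nl <> Some c &
     forall B, nstep (NNode n I (PPar B R) mu h) nl
                     (NNode n I' (PPar B R') mu h)]).
Proof.
move=> invA rc cR; case/nstep_node_par=> [d v A' rd _|[l [A' [I' [sA fI ->]]]]|
  [l [R' [I' [sR fI ->]]]]].
- by split=> /invA[w []] // [ed _]; rewrite ed in rd.
- left; exists l, A'; have [w el] := invA _ _ sA.
  have eI : I' = I by case: el fI => -> fI; inversion fI.
  by subst I'.
- right; exists I', R'; rewrite !chan_inE in cR *; split=> //.
  + by apply: contra cR; apply: has_prefix_pstep sR.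
  + move=> ec; case/negP: cR; apply: (pstep_prefix sR).
    by case: fI ec => //= d w _ [->]; rewrite eqxx.
  + by move=> B; apply: nstep_fire fI; apply: pstep_parr.
Qed.

(** The restriction stops the labels on [c], the contexts offer no other partner on [c], and
    infinite range makes the two halves reachable from each other at any distance. So each half can
    move only together with the other. *)
Lemma remote_comm_expands (C : cait) n m (I J : iface C) c v P S R Q T U
    mu mu' h k :
  wf (NRes c (NPar (NNode n I (PPar (PSend c (Val v) P S) R) mu h)
                   (NNode m J (PPar (PRecv c Q T) U) mu' k))) ->
  rng c = RInf -> ~~ chan_in c R -> ~~ chan_in c U ->
  expands
    (NRes c (NPar (NNode n I (PPar (PSend c (Val v) P S) R) mu h)
                  (NNode m J (PPar (PRecv c Q T) U) mu' k)))
    (NRes c (NPar (NNode n I (PPar P R) mu h)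
                  (NNode m J (PPar (psubst 0 v Q) U) mu' k))).
Proof.
move=> wM rc cR cU; have rc' : rng c <> RInt by rewrite rc.
pose Ml I R := NNode n I (PPar (PSend c (Val v) P S) R) mu h.
pose Mr J U := NNode m J (PPar (PRecv c Q T) U) mu' k.
pose Nl I R := NNode n I (PPar P R) mu h.
pose Nr J U := NNode m J (PPar (psubst 0 v Q) U) mu' k.
pose E M N := exists I R J U, [/\ wf M, ~~ chan_in c R, ~~ chan_in c U,
  M = NRes c (NPar (Ml I R) (Mr J U)) & N = NRes c (NPar (Nl I R) (Nr J U))].
have invS l A' : pstep (PSend c (Val v) P S) l A' -> l = LOut c v /\ A' = P.
  by move=> sA; inversion sA; subst.
have invT l A' : pstep (PRecv c Q T) l A' ->
    exists2 w, l = LIn c w & A' = psubst 0 w Q.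
  by move=> sA; inversion sA; subst; eexists.
have stepl I' R' nl X : ~~ chan_in c R' -> nstep (Ml I' R') nl X ->
    nl = NOut c v h /\ X = Nl I' R' \/
    exists I1 R1, [/\ X = Ml I1 R1, ~~ chan_in c R1, label_chan nl <> Some c &
      nstep (Nl I' R') nl (Nl I1 R1)].
  move=> cR' /(@nstep_chan_node _ c)[] //.
  - by move=> l A' /invS[-> _]; exists v; left.
  - by move=> [l [A' [/invS[-> ->] fI ->]]]; left; inversion fI.
  - by move=> [I1 [R1 [-> ? ? s]]]; right; exists I1, R1; split=> //; apply: s.
have stepr J' U' nl X : ~~ chan_in c U' -> nstep (Mr J' U') nl X ->
    (exists2 w, nl = NIn c w k & X = NNode m J' (PPar (psubst 0 w Q) U') mu' k) \/
    exists J1 U1, [/\ X = Mr J1 U1, ~~ chan_in c U1, label_chan nl <> Some c &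
      nstep (Nr J' U') nl (Nr J1 U1)].
  move=> cU' /(@nstep_chan_node _ c)[] //.
  - by move=> l A' /invT[w -> _]; exists w; right.
  - by move=> [l [A' [/invT[w -> ->] fI ->]]]; left; exists w => //; inversion fI.
  - by move=> [J1 [U1 [-> ? ? s]]]; right; exists J1, U1; split=> //; apply: s.
have tauM I' R' J' U' : nstep (NPar (Ml I' R') (Mr J' U')) (NTau C)
                              (NPar (Nl I' R') (Nr J' U')).
  apply: (@nstep_coml _ _ _ _ _ c v k h); last by rewrite rc.
    by apply: nstep_out rc'; apply/pstep_parl/pstep_out.
  by apply: nstep_in rc'; apply/pstep_parl/pstep_in.
apply: (@tau_expansion _ E); last by exists I, R, J, U.
  move=> M N [I' [R' [J' [U' [wM' _ _ eM eN]]]]]; subst; split=> //.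
  exact: nstep_res (tauM _ _ _ _) _.
move=> {I J R U wM cR cU} M N l M' [I [R [J [U [wM cR cU eM eN]]]]] sM.
have wM' := wf_estep sM wM.
have step nl : nstep M nl M' ->
    (nl = NTau C /\ M' = N) \/ exists2 N', nstep N nl N' & E M' N'.
  subst M N => sM'; inversion sM' as [| | | | | | | | | | |? ? ? X sX lc]; subst.
  have left1 I1 R1 : ~~ chan_in c R1 -> X = NPar (Ml I1 R1) (Mr J U) ->
      nstep (Nl I R) nl (Nl I1 R1) -> exists2 N', nstep
        (NRes c (NPar (Nl I R) (Nr J U))) nl N' & E (NRes c X) N'.
    move=> cR1 eX sN; exists (NRes c (NPar (Nl I1 R1) (Nr J U))).
      by apply: nstep_res lc; apply: nstep_parl.
    by exists I1, R1, J, U; rewrite -eX.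
  have right1 J1 U1 : ~~ chan_in c U1 -> X = NPar (Ml I R) (Mr J1 U1) ->
      nstep (Nr J U) nl (Nr J1 U1) -> exists2 N', nstep
        (NRes c (NPar (Nl I R) (Nr J U))) nl N' & E (NRes c X) N'.
    move=> cU1 eX sN; exists (NRes c (NPar (Nl I R) (Nr J1 U1))).
      by apply: nstep_res lc; apply: nstep_parr.
    by exists I, R, J1, U1; rewrite -eX.
  inversion sX; subst.
  - move: H1 H2 => /(stepl _ _ _ _ cR) sl /(stepr _ _ _ _ cU) sr.
    (* If the pending output takes part, its partner must be the pending input, which then receives
       [v]. Otherwise both labels are off [c] and the contexts synchronise in the same way on the
       other side. *)
    case: sl => [[[ec ev _] ->]|[I1 [R1 [eM1 cR1 dc sl]]]].
      subst; case: sr => [[w [<- _] ->]|[J1 [U1 [_ _ /=]]]] //; by left.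
    case: sr => [[w [ed _ _] _]|[J1 [U1 [eN1 cU1 _ sr]]]].
      by case: dc; rewrite /= ed.
    right; exists (NRes c (NPar (Nl I1 R1) (Nr J1 U1))).
      by apply: nstep_res lc; apply: nstep_coml sl sr _.
    by exists I1, R1, J1, U1; split=> //; rewrite eM1 eN1.
  - move: H1 H2 => /(stepr _ _ _ _ cU) sr /(stepl _ _ _ _ cR) sl.
    (* Here the right node sends and the left one receives, the opposite polarity to that of the
       pending prefixes, so only the contexts can be involved. *)
    case: sl => [[]//|[I1 [R1 [eM1 cR1 dc sl]]]].
    case: sr => [[w //]|[J1 [U1 [eN1 cU1 _ sr]]]].
    right; exists (NRes c (NPar (Nl I1 R1) (Nr J1 U1))).
      by apply: nstep_res lc; apply: nstep_comr sr sl _.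
    by exists I1, R1, J1, U1; split=> //; rewrite eM1 eN1.
  - case: (stepl _ _ _ _ cR H3) => [[el _]|[I1 [R1 [eM1 cR1 _ sl]]]].
      by case: lc; rewrite el.
    by right; apply: left1 sl; rewrite ?eM1.
  - case: (stepr _ _ _ _ cU H3) => [[w el _]|[J1 [U1 [eN1 cU1 _ sr]]]].
      by case: lc; rewrite el.
    by right; apply: right1 sr; rewrite ?eN1.
case: sM wM wM' eM step => {l M M'} [M M' sM|M M' tM|M M' a sM|M M' d w l l' sM dl|
  M M' d w l l' sM dl|M s w l sv|M a w l bM] wM wM' eM step.
- case: (step _ sM) => [[_ ->]|[N' sN SN]]; first by left.
  by right; exists N'; first exact: estep_tau.
- subst M; exfalso; inversion tM; subst.
  match goal with H : ntick _ _ |- _ => inversion H; subst end.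
  by match goal with H : ~ _ |- _ => apply: H; eexists; apply: tauM end.
- case: (step _ sM) => [[]//|[N' sN SN]].
  by right; exists N'; first exact: estep_act.
- case: (step _ sM) => [[]//|[N' sN SN]].
  by right; exists N'; first exact: estep_out dl.
- case: (step _ sM) => [[]//|[N' sN SN]].
  by right; exists N'; first exact: estep_in dl.
- right; exists (nupd s l w N); first exact: estep_sense.
  subst M N.
  exists (if (h == l) && isSome (I (inl s)) then iupd I (inl s) w else I), R.
  by exists (if (k == l) && isSome (J (inl s)) then iupd J (inl s) w else J), U.
- right; exists N; last by exists I, R, J, U.
  by apply: estep_barb; move/offers_barb: bM; subst M N => bM; apply: barb_res_par.
Qed.

(** * Bisimilarity with inactive networks *)

Lemma nil_nstep (C : cait) n (I : iface C) mu h l X :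
  ~ nstep (NNode n I PNil mu h) l X.
Proof. by case/nstep_node_inv=> [k [P' [I' [sP _ _]]]]; inversion sP. Qed.

(** A mobile node chooses its new location when it ticks. The last conjunct hands that choice over
    to any quiet node of the same mobility starting at [h], which keeps two related nodes at the
    same place. *)
Lemma ntick_node_inv (C : cait) n (I : iface C) P mu h X :
  ntick (NNode n I P mu h) X ->
  exists P' k, [/\ ptick P P', X = NNode n I P' mu k &
    forall m J Q Q', ptick Q Q' ->
      ~ (exists O, nstep (NNode m J Q mu h) (NTau C) O) ->
      ntick (NNode m J Q mu h) (NNode m J Q' mu k)].
Proof.
move=> tP; inversion tP; subst; exists P'.
- by exists h; split=> //; constructor.
- by exists k; split=> //; constructor.
Qed.

(** Both nodes keep the same interface, since it is modified only by sensor updates of the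
    environment, which reach both; so their barbs agree. The location is part of the relation
    because mobile nodes wander. *)
Lemma silent_bisimilar_nil (C : cait) n (I : iface C) P mu h :
  wf (NNode n I P mu h) -> ~~ has_comm P -> ~~ has_act P ->
  bisimilar (NNode n I P mu h) (NNode n I PNil mu h).
Proof.
move=> wM cP aP.
pose S M N := exists I P h, [/\ wf M, ~~ has_comm P, ~~ has_act P,
  M = NNode n I P mu h & N = NNode n I PNil mu h].
have upd J Q k s v l : wf (NNode n J Q mu k) -> ~~ has_comm Q -> ~~ has_act Q ->
    S (nupd s l v (NNode n J Q mu k)) (nupd s l v (NNode n J PNil mu k)).
  move=> wQ cQ aQ.
  exists (if (k == l) && isSome (J (inl s)) then iupd J (inl s) v else J), Q, k.
  by split=> //; apply: wf_nupd.
have nil_quiet J k : ~ (exists O, nstep (NNode n J PNil mu k) (NTau C) O).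
  by case=> O; apply: nil_nstep.
apply: (@bisimilar_by _ S); last by exists I, P, h.
- move=> M N [J [Q [k [wQ _ _ eM eN]]]]; subst; split=> //.
  exact: wf_node_step wQ _ _ _.
- move=> {I P h wM cP aP} M N l M' [I [P [h [wM cP aP eM eN]]]] sM.
  have wM' := wf_estep sM wM; rewrite has_commE has_actE in cP aP.
  case: sM wM wM' eM => {l M M'} [M M' sM|M M' tM|M M' a sM|M M' c v k k' sM d|
    M M' c v k k' sM d|M s v k sv|M a v k bM] wM wM' eM; subst M N.
  + case/nstep_node_inv: sM => [l [P' [I' [sP /fire_tau_iface eI eM']]]]; subst.
    exists (NNode n I PNil mu h); first exact: taus_refl.
    exists I, P', h; rewrite has_commE has_actE; split=> //.
      by apply: contra cP; apply: has_prefix_pstep sP.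
    by apply: contra aP; apply: has_prefix_pstep sP.
  + case/ntick_node_inv: tM => [P' [k [tP eM' tN]]]; subst.
    exists (NNode n I PNil mu k).
      by apply/estep_weakhat/estep_sigma/tN => //; apply: ptick_nil.
    exists I, P', k; rewrite has_commE has_actE; split=> //.
      by apply: contra cP; apply: has_prefix_ptick tP.
    by apply: contra aP; apply: has_prefix_ptick tP.
  + case/nstep_node_inv: sM => [l [P' [I' [sP fI _]]]].
    by case/negP: aP; apply: (pstep_prefix sP); inversion fI.
  + case/nstep_node_inv: sM => [l [P' [I' [sP fI _]]]].
    by case/negP: cP; apply: (pstep_prefix sP); inversion fI.
  + case/nstep_node_inv: sM => [l [P' [I' [sP fI _]]]].
    by case/negP: cP; apply: (pstep_prefix sP); inversion fI.
  + exists (nupd s k v (NNode n I PNil mu h)).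
      exact/estep_weakhat/estep_sense.
    by apply: upd; rewrite ?has_commE ?has_actE.
  + exists (NNode n I PNil mu h).
      by move/offers_barb: bM => [<- Ia]; apply/estep_weakhat/estep_barb/barb_node.
    by exists I, P, h; rewrite has_commE has_actE.
- move=> {I P h wM cP aP} M N l N' [I [P [h [wM cP aP eM eN]]]] sN.
  case: sN eN => {l N N'} [N N' sN|N N' tN|N N' a sN|N N' c v k k' sN d|
    N N' c v k k' sN d|N s v k sv|N a v k bN] eN; subst M N.
  1,3-5: by case: (nil_nstep sN).
  + case/ntick_node_inv: tN => [Q' [k [tQ -> tM]]].
    inversion tQ; subst.
    have [P1 [P2 [tP tP1 quiet wP1 [cP1 aP1]]]] := settle wM cP aP.
    have sM1 := tM _ _ _ _ tP1 quiet.
    exists (NNode n I P2 mu k).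
      by exists (NNode n I P1 mu h), (NNode n I P2 mu k); split=> //;
        [apply: estep_sigma | apply: taus_refl].
    rewrite has_commE has_actE in cP1 aP1.
    exists I, P2, k; rewrite has_commE has_actE; split=> //.
    * exact: wf_ntick sM1 wP1.
    * by apply: contra cP1; apply: has_prefix_ptick tP1.
    * by apply: contra aP1; apply: has_prefix_ptick tP1.
  + exists (nupd s k v (NNode n I P mu h)); first exact/estep_weakhat/estep_sense.
    exact: upd.
  + exists (NNode n I P mu h).
      by move/offers_barb: bN => [<- Ia]; apply/estep_weakhat/estep_barb/barb_node.
    by exists I, P, h.
Qed.

Lemma ntick_node_here (C : cait) n (I : iface C) P P' mu h :
  ptick P P' -> ~ (exists O, nstep (NNode n I P mu h) (NTau C) O) ->
  ntick (NNode n I P mu h) (NNode n I P' mu h).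
Proof.
by case: mu => tP quiet; constructor=> //; rewrite dist_self.
Qed.

(** Barbs show actuator values only, so with no actuator neither the sensor values nor the location
    of the node can be observed, and both may vary freely in the relation. *)
Lemma nil_bisimilar_empty (C : cait) n (I : iface C) mu h :
  wf (NNode n I PNil mu h) -> (forall a, I (inr a) = None) ->
  bisimilar (NNode n I PNil mu h) NNil.
Proof.
move=> wM noact.
pose S (M N : net C) := exists I h, [/\ wf M, forall a, I (inr a) = None,
  M = NNode n I PNil mu h & N = NNil].
have upd J k s v l : wf (NNode n J PNil mu k) -> (forall a, J (inr a) = None) ->
    S (nupd s l v (NNode n J PNil mu k)) (nupd s l v NNil).
  move=> wJ noJ; exists (if (k == l) && isSome (J (inl s)) then iupd J (inl s) v else J).
  by exists k; split=> //; [apply: wf_nupd | case: ifP].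
apply: (@bisimilar_by _ S); last by exists I, h.
- by move=> M N [J [k [wJ _ _ ->]]].
- move=> {I h wM noact} M N l M' [I [h [wM noact eM ->]]] sM.
  have wM' := wf_estep sM wM.
  case: sM wM wM' eM => {l M M'} [M M' sM|M M' tM|M M' a sM|M M' c v k k' sM d|
    M M' c v k k' sM d|M s v k sv|M a v k bM] wM wM' eM; subst M.
  1,3-5: by case: (nil_nstep sM).
  + case/ntick_node_inv: tM wM' => [P' [k [tP -> _]]] wM'; inversion tP; subst.
    exists NNil; last by exists I, k.
    exact/estep_weakhat/estep_sigma/ntick_nil.
  + exists NNil; last exact: upd.
    by apply: (@estep_weakhat _ NNil); apply: (@estep_sense _ NNil).
  + by case/offers_barb: bM => _; rewrite noact.
- move=> {I h wM noact} M N l N' [I [h [wM noact eM eN]]] sN.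
  case: sN eN => {l N N'} [N N' sN|N N' tN|N N' a sN|N N' c v k k' sN d|
    N N' c v k k' sN d|N s v k sv|N a v k bN] eN; subst M N.
  1,3-5: by inversion sN.
  + inversion tN; exists (NNode n I PNil mu h); last by exists I, h.
    apply/estep_weakhat/estep_sigma/ntick_node_here; first exact: ptick_nil.
    by case=> O; apply: nil_nstep.
  + exists (nupd s k v (NNode n I PNil mu h)); last exact: upd.
    exact/estep_weakhat/estep_sense.
  + by case/offers_barb: bN.
Qed.

(** * Position independence of nodes with an empty interface *)

Lemma nupd_iface0 (C : cait) n (P : proc C) mu k s h v :
  nupd s h v (NNode n iface0 P mu k) = NNode n iface0 P mu k.
Proof. by rewrite /= andbF. Qed.

(** An empty interface disables sensing and actuation, and without [PLoc] the process cannot learn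
    its position. What remains is communication, where the location enters only the label; visible
    channels have infinite range. *)
Lemma nstep_node_iface0 (C : cait) n m (P : proc C) mu mu' h k nl X :
  ~~ has_loc P -> (forall c, chan_in c P -> rng c = RInf \/ rng c = RInt) ->
  nstep (NNode n iface0 P mu h) nl X ->
  exists P', [/\ X = NNode n iface0 P' mu h,
    forall f, has_prefix f P' -> has_prefix f P &
    match nl with
    | NTau => nstep (NNode m iface0 P mu' k) (NTau C) (NNode m iface0 P' mu' k)
    | NAct _ => False
    | NOut c v _ => rng c = RInf /\
        nstep (NNode m iface0 P mu' k) (NOut c v k) (NNode m iface0 P' mu' k)
    | NIn c v _ => rng c = RInf /\
        nstep (NNode m iface0 P mu' k) (NIn c v k) (NNode m iface0 P' mu' k)
    end].
Proof.
rewrite has_locE => noloc chanP.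
have chan_inf pl P' c : pstep P pl P' ->
    oapp (on_chan c) false (label_prefix pl) -> rng c <> RInt -> rng c = RInf.
  by move=> sP lc; case: (chanP c) => //; rewrite chan_inE (pstep_prefix sP lc).
case/nstep_node_inv=> [pl [P' [I' [sP fI ->]]]].
have sub f : has_prefix f P' -> has_prefix f P by apply: has_prefix_pstep sP.
exists P'; case: fI sP => //.
- by move=> sP; case/negP: noloc; apply: (pstep_prefix sP).
- by move=> sP; split=> //; apply: nstep_loccom.
- move=> c v rc sP; have ri := chan_inf _ _ c sP; split=> //; split.
    by apply: ri; rewrite /= ?eqxx.
  exact: nstep_out.
- move=> c v rc sP; have ri := chan_inf _ _ c sP; split=> //; split.
    by apply: ri; rewrite /= ?eqxx.
  exact: nstep_in.
Qed.

(** Extensional labels record the observer's position, which infinite range places within reach of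
    every sender and receiver. The answering node can therefore stay at [k] for good, even when the
    other one moves to [h']. *)
Lemma estep_node_iface0 (C : cait) n m (P : proc C) mu mu' h k l X :
  ~~ has_loc P -> (forall c, chan_in c P -> rng c = RInf \/ rng c = RInt) ->
  estep (NNode n iface0 P mu h) l X ->
  exists P' h', [/\ X = NNode n iface0 P' mu h',
    estep (NNode m iface0 P mu' k) l (NNode m iface0 P' mu' k) &
    forall f, has_prefix f P' -> has_prefix f P].
Proof.
move=> noloc chanP sM.
have step := @nstep_node_iface0 _ n m P mu mu' h k _ _ noloc chanP.
(* A tick is answered only if the second node is quiet too, so its tau-steps are carried back to the
   first node, with the roles exchanged. *)
have quiet : ~ (exists O, nstep (NNode n iface0 P mu h) (NTau C) O) ->
    ~ (exists O, nstep (NNode m iface0 P mu' k) (NTau C) O).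
  move=> q [O sO]; apply: q.
  have [P' [_ _ s]] := @nstep_node_iface0 _ m n P mu' mu k h _ _ noloc chanP sO.
  by exists (NNode n iface0 P' mu h).
have tick Y : ntick (NNode n iface0 P mu h) Y -> exists P' h',
    [/\ Y = NNode n iface0 P' mu h', ptick P P' &
        ~ (exists O, nstep (NNode n iface0 P mu h) (NTau C) O)].
  by move=> tM; inversion tM; subst; exists P'; eexists; split; eauto.
inversion sM as [M M' sM'|M M' tM|M M' a sM'|M M' c v l1 l2 sM' d|
  M M' c v l1 l2 sM' d|M s v l1 sv|M a v l1 bM]; subst.
- case: (step _ _ sM') => [P' [-> sub s]]; exists P', h; split=> //.
  exact: estep_tau.
- case: (tick _ tM) => [P' [h' [-> tP q]]]; exists P', h'; split=> //.
    by apply/estep_sigma/ntick_node_here => //; apply: quiet.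
  by move=> f; apply: has_prefix_ptick tP.
- by case: (step _ _ sM') => [P' []].
- case: (step _ _ sM') => [P' [-> sub [rc s]]]; exists P', h; split=> //.
  by apply: estep_out s _; rewrite rc.
- case: (step _ _ sM') => [P' [-> sub [rc s]]]; exists P', h; split=> //.
  by apply: estep_in s _; rewrite rc.
- exists P, h; split; rewrite ?nupd_iface0 //.
  by rewrite -{2}(nupd_iface0 m P mu' k s l1 v); apply: estep_sense.
- by case/offers_barb: bM.
Qed.

Lemma mobility_bisimilar (C : cait) n m (P : proc C) h k :
  wf (NNode n iface0 P Mob h) -> wf (NNode m iface0 P Stat k) ->
  ~~ has_loc P -> (forall c, chan_in c P -> rng c = RInf \/ rng c = RInt) ->
  bisimilar (NNode n iface0 P Mob h) (NNode m iface0 P Stat k).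
Proof.
move=> wM wN noloc chanP.
pose S (M N : net C) := exists P h k, [/\ wf M /\ wf N, ~~ has_loc P,
  forall c, chan_in c P -> rng c = RInf \/ rng c = RInt,
  M = NNode n iface0 P Mob h & N = NNode m iface0 P Stat k].
have keep (Q Q' : proc C) : (forall f, has_prefix f Q' -> has_prefix f Q) ->
    ~~ has_loc Q -> (forall c, chan_in c Q -> rng c = RInf \/ rng c = RInt) ->
    ~~ has_loc Q' /\ (forall c, chan_in c Q' -> rng c = RInf \/ rng c = RInt).
  move=> sub; rewrite !has_locE => lQ cQ.
  split; first by apply: contra lQ; apply: sub.
  by move=> c; rewrite chan_inE => /sub; rewrite -chan_inE; apply: cQ.
apply: (@bisimilar_by _ S); last by exists P, h, k.
- by move=> M N [Q [h' [k' []]]].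
- move=> {P h k wM wN noloc chanP} M N l M' [P [h [k [[wM wN] lP cP eM eN]]]] sM.
  subst; have [P' [h' [eM' sN sub]]] := estep_node_iface0 m Stat k lP cP sM.
  exists (NNode m iface0 P' Stat k); first exact: estep_weakhat.
  have [lP' cP'] := keep _ _ sub lP cP.
  exists P', h', k; split=> //.
  by split; [apply: wf_estep sM wM | apply: wf_estep sN wN].
- move=> {P h k wM wN noloc chanP} M N l N' [P [h [k [[wM wN] lP cP eM eN]]]] sN.
  subst; have [P' [k' [eN' sM sub]]] := estep_node_iface0 n Mob h lP cP sN.
  exists (NNode n iface0 P' Mob h); first exact: estep_weakhat.
  have [lP' cP'] := keep _ _ sub lP cP.
  exists P', h, k'; split=> //.
  by split; [apply: wf_estep sM wM | apply: wf_estep sN wN].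
Qed.

Theorem theorem2 (C : cait) :
  (* (1) *)
  (forall (n : nodename C) (I : iface C) (a : actuator C)
      (v : value (data C) (loc C)) (P R : proc C) (mu : mobility) (h : loc C),
    wf (NNode n I (PPar (PAct a (Val v) P) R) mu h) ->
    I (inr a) = Some v -> ~~ act_in a R ->
    expands (NNode n I (PPar (PAct a (Val v) P) R) mu h)
            (NNode n I (PPar P R) mu h)) /\
  (* (2) *)
  (forall (n : nodename C) (I : iface C) (P R : proc C) (mu : mobility)
      (h : loc C),
    wf (NNode n I (PPar (PLoc P) R) mu h) ->
    expands (NNode n I (PPar (PLoc P) R) mu h)
            (NNode n I (PPar (psubst 0 (VLoc h) P) R) mu h)) /\
  (* (3) *)
  (forall (n : nodename C) (I : iface C) (c : chan C)
      (v : value (data C) (loc C)) (P S Q T R : proc C) (mu : mobility)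
      (h : loc C),
    wf (NNode n I (PPar (PPar (PSend c (Val v) P S) (PRecv c Q T)) R) mu h) ->
    ~~ chan_in c R -> rng c = RInt ->
    expands
      (NNode n I (PPar (PPar (PSend c (Val v) P S) (PRecv c Q T)) R) mu h)
      (NNode n I (PPar (PPar P (psubst 0 v Q)) R) mu h)) /\
  (* (4) *)
  (forall (n m : nodename C) (I J : iface C) (c : chan C)
      (v : value (data C) (loc C)) (P S R Q T U : proc C)
      (mu mu' : mobility) (h k : loc C),
    wf (NRes c (NPar (NNode n I (PPar (PSend c (Val v) P S) R) mu h)
                     (NNode m J (PPar (PRecv c Q T) U) mu' k))) ->
    rng c = RInf -> ~~ chan_in c R -> ~~ chan_in c U ->
    expands
      (NRes c (NPar (NNode n I (PPar (PSend c (Val v) P S) R) mu h)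
                    (NNode m J (PPar (PRecv c Q T) U) mu' k)))
      (NRes c (NPar (NNode n I (PPar P R) mu h)
                    (NNode m J (PPar (psubst 0 v Q) U) mu' k)))) /\
  (* (5) *)
  (forall (n : nodename C) (I : iface C) (P : proc C) (mu : mobility)
      (h : loc C),
    wf (NNode n I P mu h) -> ~~ has_comm P -> ~~ has_act P ->
    bisimilar (NNode n I P mu h) (NNode n I PNil mu h)) /\
  (* (6) *)
  (forall (n : nodename C) (I : iface C) (mu : mobility) (h : loc C),
    wf (NNode n I PNil mu h) -> (forall a, I (inr a) = None) ->
    bisimilar (NNode n I PNil mu h) NNil) /\
  (* (7) *)
  (forall (n m : nodename C) (P : proc C) (h k : loc C),
    wf (NNode n iface0 P Mob h) -> wf (NNode m iface0 P Stat k) ->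
    ~~ has_loc P ->
    (forall c, chan_in c P -> rng c = RInf \/ rng c = RInt) ->
    bisimilar (NNode n iface0 P Mob h) (NNode m iface0 P Stat k)).
Proof.
do !split.
- exact: actuation_expands.
- exact: position_expands.
- exact: local_comm_expands.
- exact: remote_comm_expands.
- exact: silent_bisimilar_nil.
- exact: nil_bisimilar_empty.
- exact: mobility_bisimilar.
Qed.
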